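(* Let $\mathcal{H}$ be a real or complex Hilbert space with a fixed orthonormal basis $\{e_x : x \in X\}$, and let $\mathcal{H}_1, \mathcal{H}_2$ be Hilbert spaces (over the same field, each with a fixed orthonormal basis). Suppose $C_1, C_2 : \mathcal{H}_1 \to \mathcal{H}$ and $C_3 : \mathcal{H}_2 \to \mathcal{H}$ are Hilbert--Schmidt operators, and define $J := \{ x \in X : C_3^* e_x \neq 0 \}$. If $(C_1 C_1^* )_{J \times J}$ and $(C_2 C_2^* )_{J \times J}$ are nonzero, then $$C_3^* (C_1 C_1^* \circ C_2 C_2^* ) C_3 \ \geq \ \gamma(C_1, C_2, J) \cdot C_3^*\, d_{C_1 C_2^T}\, d_{C_1 C_2^T}^*\, C_3, \qquad \gamma(C_1, C_2, J) := \frac{1}{\min(\operatorname{rk}\,(C_1 C_1^* )_{J \times J},\ \operatorname{rk}\,(C_2 C_2^* )_{J \times J})}.$$ Moreover, the coefficient $\gamma(C_1,C_2,J)$ is best possible.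
   Context: Inner products $\langle\cdot,\cdot\rangle$ are linear in the second argument. Orthonormal bases are Hilbert space bases (dense span). A linear operator $A : \mathcal{H} \to \mathcal{H}'$ is Hilbert--Schmidt if $\sum_{x} \|A e_x\|^2 < \infty$. For $u \in \mathcal{H}$, $u^*$ denotes the linear functional $\langle u, \cdot\rangle$. For an operator $A : \mathcal{H} \to \mathcal{H}'$, where $\mathcal{H}'$ has orthonormal basis $\{f_y : y \in Y\}$, $A^*$ is the adjoint, and the transpose $A^T : \mathcal{H}' \to \mathcal{H}$ (relative to the fixed bases) is given by $\langle A^T f_y, e_x\rangle := \langle A e_x, f_y\rangle$ for $x \in X, y \in Y$. For Hilbert--Schmidt operators $A, B$ on $\mathcal{H}$, the Schur product $A \circ B$ (relative to $\{e_x\}$) is the operator determined by $\langle e_y, (A \circ B) e_x\rangle := \langle e_y, A e_x\rangle \langle e_y, B e_x\rangle$ for $x,y\in X$. For an operator $A$ on $\mathcal{H}$ and $J \subset X$, $A_{J\times J} := P_J A P_J$, where $P_J$ is the orthogonal projection onto the closed span of $\{e_j : j \in J\}$. For a Hilbert--Schmidt operator $A$ on $\mathcal{H}$, $d_A \in \mathcal{H}$ is the vector with $\langle e_x, d_A\rangle := \langle e_x, A e_x\rangle$ for all $x \in X$. A bounded operator $A$ is positive if $A = A^*$ and $\langle u, Au\rangle \geq 0$ for all $u$; $S \geq T$ means that $S - T$ is positive. Ranks ($\operatorname{rk}$) may be infinite; if both ranks in the definition of $\gamma(C_1,C_2,J)$ are infinite, then $\gamma(C_1,C_2,J)$ is taken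 to be $0$. *)

(* Defs.v *)
From HB Require Import structures.
From mathcomp Require Import all_boot all_order all_algebra.
From mathcomp Require Import sesquilinear finmap.
From mathcomp Require Import all_classical all_reals all_analysis.
From mathcomp Require Import complex.

Set Implicit Arguments.
Unset Strict Implicit.
Unset Printing Implicit Defensive.

Import Order.TTheory GRing.Theory Num.Theory.
Import numFieldNormedType.Exports.
Local Open Scope classical_set_scope.
Local Open Scope ring_scope.

(* The scalar field together with its conjugation: R (trivial conjugation) or
   C = R[i].  In both cases [x <= y] in K says that y - x is a nonnegative real
   number, so inequalities between scalars are stated in K itself. *)
Variant real_or_complex : forall K : numFieldType, (K -> K) -> Prop :=
| RealScalars (R : realType) : @real_or_complex R idfun
| ComplexScalars (R : realType) : @real_or_complex R[i] (@conjc R).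

Record hilbertType (K : numFieldType) (conj : K -> K) := HilbertType {
  hilbert_sort :> completeNormedModType K;
  hilbert_form : {dot hilbert_sort for conj};
  hilbert_normE : forall u : hilbert_sort, `|u| ^+ 2 = hilbert_form u u }.

(* MathComp's sesquilinear forms are linear in the first argument; the inner
   product is linear in the second one, hence the swap. *)
Definition ip (K : numFieldType) (conj : K -> K) (H : hilbertType conj)
  (u v : H) : K := hilbert_form H v u.

Section Hilbert.
Context {K : numFieldType} {conj : K -> K}.
Implicit Types H G : hilbertType conj.

Definition lin_span H (S : set H) : set H :=
  [set u | exists n (c : 'I_n -> K) (b : 'I_n -> H),
     (forall i, S (b i)) /\ u = \sum_i c i *: b i].

Definition orthonormal_basis H (X : choiceType) (e : X -> H) : Prop :=
  (forall x y, ip (e x) (e y) = (x == y)%:R) /\ dense (lin_span (range e)).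

Definition bounded_op H G (A : H -> G) : Prop := linear A /\ continuous A.

(* The partial sums of \sum_x |A e_x|^2 over finite sets of indices are bounded,
   i.e. the unordered sum of nonnegative terms is finite. *)
Definition hilbert_schmidt H G (X : choiceType) (e : X -> H) (A : H -> G)
  : Prop :=
  bounded_op A /\
  exists M : K, forall F : {fset X}, \sum_(x <- F) `|A (e x)| ^+ 2 <= M.

(* The objects below are characterized by equations having at most one solution,
   and are given the value 0 when there is none. *)

Definition adjoint H G (A : H -> G) : G -> H :=
  fun v => xget 0 [set w | forall u, ip w u = ip v (A u)].

Definition transpose H G (X Y : choiceType) (e : X -> H) (f : Y -> G)
  (A : H -> G) : G -> H :=
  xget (fun=> 0) [set B : G -> H | bounded_op B /\
    forall x y, ip (B (f y)) (e x) = ip (A (e x)) (f y)].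

Definition schur H (X : choiceType) (e : X -> H) (A B : H -> H) : H -> H :=
  xget (fun=> 0) [set C : H -> H | bounded_op C /\
    forall x y, ip (e y) (C (e x)) = ip (e y) (A (e x)) * ip (e y) (B (e x))].

Definition diag_vec H (X : choiceType) (e : X -> H) (A : H -> H) : H :=
  xget 0 [set d | forall x, ip (e x) d = ip (e x) (A (e x))].

Definition orth_proj H (S : set H) : H -> H :=
  fun u => xget 0 [set w | S w /\ forall v, S v -> ip v (u - w) = 0].

Definition coord_proj H (X : choiceType) (e : X -> H) (J : set X) : H -> H :=
  orth_proj (closure (lin_span (e @` J))).

Definition compress H (X : choiceType) (e : X -> H) (J : set X) (A : H -> H)
  : H -> H := coord_proj e J \o A \o coord_proj e J.

(* The rank-one operator d d^*. *)
Definition outer H (d : H) : H -> H := fun u => ip d u *: d.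

Definition positive_op H (A : H -> H) : Prop :=
  [/\ bounded_op A, A = adjoint A & forall u, 0 <= ip u (A u)].

Definition op_ge H (S T : H -> H) : Prop := positive_op (fun u => S u - T u).

Definition has_dim H (S : set H) (n : nat) : Prop :=
  exists b : 'I_n -> H,
    (forall c : 'I_n -> K, \sum_i c i *: b i = 0 -> forall i, c i = 0) /\
    S = [set u | exists c : 'I_n -> K, u = \sum_i c i *: b i].

(* [None] stands for infinite rank. *)
Definition rank H G (A : H -> G) : option nat :=
  xget None [set r | exists2 n, r = Some n & has_dim (range A) n].

Definition inv_min_rank (r s : option nat) : K :=
  match r, s with
  | Some m, Some n => (minn m n)%:R^-1
  | Some m, None => m%:R^-1
  | None, Some n => n%:R^-1
  | None, None => 0
  end.

Definition gamma H H1 (X : choiceType) (e : X -> H) (J : set X)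
  (C1 C2 : H1 -> H) : K :=
  inv_min_rank (rank (compress e J (C1 \o adjoint C1)))
               (rank (compress e J (C2 \o adjoint C2))).

Definition schur_lower_bound H H1 H2 (X Y : choiceType)
  (e : X -> H) (f : Y -> H1) (C1 C2 : H1 -> H) (C3 : H2 -> H) (c : K) : Prop :=
  op_ge (adjoint C3 \o schur e (C1 \o adjoint C1) (C2 \o adjoint C2) \o C3)
    (fun v => c *: (adjoint C3
                    \o outer (diag_vec e (C1 \o transpose f e C2)) \o C3) v).

End Hilbert.

(* Main.v *)
(** Put [w = C3 v], which is supported on [J].  Writing [a], [b] for the matrices
    of [C1], [C2] and [M = C1^T diag(conj w) C2], one has
    [<w, (C1 C1^* o C2 C2^* ) w> = ||M||_HS^2] and [<w, d> = tr M], so that the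
    bound is [|tr M|^2 <= rk(M) ||M||_HS^2].  Infinite sums are avoided: by
    continuity [w] may be taken with finite support in [J], and if
    [u_1, ..., u_k] is a maximal orthonormal family in the image under [C1^*] of
    the vectors supported on [J], then [k <= rk (C1 C1^* )_{J x J}] and expanding
    the vectors [C1^* e_x] along the [u_i] leaves a Cauchy-Schwarz inequality
    with [k] terms.

    For optimality, take [C1'], [C2'] diagonal, [f_{y_i} |-> a_i e_{x_i}] and
    [f_{y_i} |-> b_i e_{x_i}], with [a_i b_i = 1 / conj w_{x_i}] for [i < N] and
    [a_i b_i = 0] for [i >= N]: then [|tr M|^2 = N^2] and [||M||_HS^2 = N]. *)
Require Import Defs.
From HB Require Import structures.
From mathcomp Require Import all_boot all_order all_algebra.
From mathcomp Require Import finmap complex.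
From mathcomp Require Import all_classical all_reals all_analysis.

Set Implicit Arguments.
Unset Strict Implicit.
Unset Printing Implicit Defensive.

Import Order.TTheory GRing.Theory Num.Theory.
Import numFieldNormedType.Exports.
Local Open Scope classical_set_scope.
Local Open Scope ring_scope.

(** * Scalars and inner products *)

(** The frame argument needs only one of the two ranks to be finite. Both [<w, d>] and the Schur
    form are unchanged when [C1] and [C2] are exchanged, so each finite rank gives a bound of its
    own and the minimum comes for free. If both ranks are infinite, only positivity of the Schur
    form is at stake; it is obtained by compressing to the finite support of [w], where the rank is
    finite again.

    The adjoint, the transpose, the Schur product, the diagonal vector and the projections are
    chosen by [xget] with default value 0, so each must first be shown to solve its defining
    equations. The solutions are all built with Riesz-Fischer, from bounds on finite partial sums.

    For optimality, [C1'] and [C2'] must have exactly the prescribed ranks. Hence [a] and [b] may be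
    nonzero beyond the first [N] indices, but on disjoint sets, which raises the ranks without
    changing the products [a_i b_i]. When both ranks are infinite, [N] is any integer above [1 / c],
    and the two disjoint sets are taken among the even and the odd indices. *)

Section Scalars.
Context {K : numFieldType} {conj : K -> K} (hK : real_or_complex conj).

Lemma conjD : {morph conj : x y / x + y}.
Proof. by case: _ _ / hK => [R|R] x y //; rewrite rmorphD. Qed.

Lemma conjM : {morph conj : x y / x * y}.
Proof. by case: _ _ / hK => [R|R] x y //; rewrite rmorphM. Qed.

Lemma conj_invol : involutive conj.
Proof. by case: _ _ / hK => [R|R] // x; rewrite conjcK. Qed.

Lemma mul_conj x : x * conj x = `|x| ^+ 2.
Proof.
by case: _ _ / hK x => [R|R] x; [rewrite real_normK ?num_real | rewrite sqr_normc].
Qed.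

Lemma archi (x : K) : exists n : nat, `|x| < n%:R.
Proof.
case: _ _ / hK x => [R|R] x; first by exists (Num.bound `|x|); exact: archi_boundP.
rewrite normc_def; set r := Num.sqrt _.
exists (Num.bound r); rewrite -(rmorph_nat (@real_complex R)) /=.
rewrite ltcR; apply: archi_boundP; exact: sqrtr_ge0.
Qed.

Lemma conj0 : conj 0 = 0.
Proof. by apply: (addrI (conj 0)); rewrite -conjD !addr0. Qed.

Lemma conjN : {morph conj : x / - x}.
Proof. by move=> x; apply: (addrI (conj x)); rewrite -conjD !subrr conj0. Qed.

Lemma conjB : {morph conj : x y / x - y}.
Proof. by move=> x y; rewrite conjD conjN. Qed.

Lemma conj_eq0 x : (conj x == 0) = (x == 0).
Proof. by rewrite (can2_eq conj_invol conj_invol) conj0. Qed.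

Lemma conj_sum I (r : seq I) P (F : I -> K) :
  conj (\sum_(i <- r | P i) F i) = \sum_(i <- r | P i) conj (F i).
Proof. exact: (big_morph conj conjD conj0). Qed.

Lemma conj_real x : x \is Num.real -> conj x = x.
Proof.
move=> xr; have [->|x0] := eqVneq x 0; first exact: conj0.
by apply: (mulfI x0); rewrite mul_conj real_normK.
Qed.

Lemma norm_conj x : `|conj x| = `|x|.
Proof.
apply/eqP; rewrite -(@eqrXn2 _ 2) //; apply/eqP.
by rewrite -!mul_conj conj_invol mulrC.
Qed.

(** The order of [K] is partial, so [x <= y] cannot be refuted before [x] and [y] are known to be
    comparable. The instance [e = 1] shows that [y - x] is real; after that, [e = (x - y) / 2] gives
    the contradiction. *)
Lemma le_epsP (x y : K) : (forall e, 0 < e -> x <= y + e) -> x <= y.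
Proof.
move=> h; have := h 1 ltr01; rewrite -subr_ge0 => xyr.
have r : y - x \is Num.real.
  have -> : y - x = (y + 1 - x) - 1 by rewrite addrAC addrK.
  by rewrite rpredB // ger0_real.
rewrite -subr_ge0 real_leNgt ?real0 //; apply/negP => lt0.
have e0 : 0 < (x - y) / 2 by rewrite divr_gt0 // -opprB oppr_gt0.
have := h _ e0; rewrite -lerBlDl -subr_ge0 {2}[x - y]splitr opprD addrA subrr.
by rewrite add0r oppr_ge0 => /(lt_le_trans e0); rewrite ltxx.
Qed.

End Scalars.

Section InnerProduct.
Context {K : numFieldType} {conj : K -> K} (hK : real_or_complex conj).
Context {H : hilbertType conj}.
Implicit Types (u v w : H).

Lemma ipC u v : ip u v = conj (ip v u).
Proof.
rewrite /ip (sesquilinear.hermitian_subproof (s := hilbert_form H)).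
by rewrite expr0 mul1r.
Qed.

Lemma ipDr u v w : ip u (v + w) = ip u v + ip u w.
Proof. by rewrite /ip -!applyrE raddfD. Qed.

Lemma ipZr u a v : ip u (a *: v) = a * ip u v.
Proof. by rewrite /ip linearZl_LR. Qed.

Lemma ipDl u v w : ip (u + v) w = ip u w + ip v w.
Proof. by rewrite ipC ipDr (conjD hK) -!ipC. Qed.

Lemma ipZl a u v : ip (a *: u) v = conj a * ip u v.
Proof. by rewrite ipC ipZr (conjM hK) -ipC. Qed.

Lemma ip0r u : ip u 0 = 0.
Proof. by rewrite -(scale0r 0) ipZr mul0r. Qed.

Lemma ip0l u : ip 0 u = 0.
Proof. by rewrite ipC ip0r (conj0 hK). Qed.

Lemma ipNr u v : ip u (- v) = - ip u v.
Proof. by rewrite -scaleN1r ipZr mulN1r. Qed.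

Lemma ipNl u v : ip (- u) v = - ip u v.
Proof. by rewrite ipC ipNr (conjN hK) -ipC. Qed.

Lemma ipBr u v w : ip u (v - w) = ip u v - ip u w.
Proof. by rewrite ipDr ipNr. Qed.

Lemma ipBl u v w : ip (u - v) w = ip u w - ip v w.
Proof. by rewrite ipDl ipNl. Qed.

Lemma ip_sumr I (r : seq I) P (F : I -> H) u :
  ip u (\sum_(i <- r | P i) F i) = \sum_(i <- r | P i) ip u (F i).
Proof. exact: (big_morph (ip u) (ipDr u) (ip0r u)). Qed.

Lemma ip_suml I (r : seq I) P (F : I -> H) u :
  ip (\sum_(i <- r | P i) F i) u = \sum_(i <- r | P i) ip (F i) u.
Proof.
apply: (big_morph (fun v => ip v u)) => [v w|]; [exact: ipDl | exact: ip0l].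
Qed.

Lemma ipvv u : ip u u = `|u| ^+ 2.
Proof. by rewrite hilbert_normE. Qed.

Lemma ip_inj u v : (forall w, ip w u = ip w v) -> u = v.
Proof.
move=> h; apply/eqP; rewrite -subr_eq0 -normr_eq0 -sqrf_eq0 -ipvv.
by rewrite {2}/GRing.add /= ipBr h subrr.
Qed.

Lemma ip_injl u v : (forall w, ip u w = ip v w) -> u = v.
Proof. by move=> h; apply: ip_inj => w; rewrite ipC h -ipC. Qed.

Lemma pythagoras u v : ip u v = 0 -> `|u + v| ^+ 2 = `|u| ^+ 2 + `|v| ^+ 2.
Proof.
move=> uv0; rewrite -!ipvv ipDr !ipDl uv0 [ip v u]ipC uv0 (conj0 hK).
by rewrite addr0 add0r.
Qed.

Lemma cauchy_schwarz u v : `|ip u v| <= `|u| * `|v|.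
Proof.
have [->|v0] := eqVneq v 0; first by rewrite ip0r !normr0 mulr0.
have n0 : 0 < `|v| by rewrite normr_gt0.
have n2 : `|v| ^+ 2 != 0 by rewrite sqrf_eq0 gt_eqF.
pose a := ip v u / `|v| ^+ 2.
have ca : conj a = ip u v / `|v| ^+ 2.
  rewrite /a (conjM hK) -ipC (conj_real hK (x := _^-1)) //.
have o : ip (u - a *: v) (a *: v) = 0.
  by rewrite ipZr ipBl ipZl ipvv ca divfK ?subrr ?mulr0.
have := pythagoras o; rewrite subrK normrZ exprMn => nu.
have e : `|a| ^+ 2 * `|v| ^+ 2 = `|ip u v| ^+ 2 / `|v| ^+ 2.
  rewrite /a normrM normfV normrX normr_id exprMn exprVn.
  rewrite [ip v u]ipC (norm_conj hK) [(_ ^+ 2) ^+ 2]expr2 invfM.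
  by rewrite -mulrA (divfK n2).
rewrite -(@ler_pXn2r _ 2) ?nnegrE ?mulr_ge0 // exprMn nu e.
by rewrite -ler_pdivrMr ?exprn_gt0 // lerDr exprn_ge0.
Qed.

End InnerProduct.

(** * Orthonormal bases *)

(** The value [t / (1 + t)] lies below both 1 and [t] without a case distinction. *)
Lemma exists_le1_le (K : numFieldType) (t : K) :
  0 < t -> exists d, [/\ 0 < d, d <= 1 & d <= t].
Proof.
move=> t0; have t1 : 0 < 1 + t by rewrite addr_gt0.
exists (t / (1 + t)); split; first by rewrite divr_gt0.
  by rewrite ler_pdivrMr // mul1r lerDr.
by rewrite ler_pdivrMr // ler_peMr ?(ltW t0) // lerDl ltW.
Qed.

(** Replaces a square root of [t]: if [d] is at most 1 and at most [t], then [d ^+ 2 <= d <= t]. *)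
Lemma sqr_small (K : numFieldType) (t : K) :
  0 < t -> exists2 d, 0 < d & d ^+ 2 <= t.
Proof.
move=> /exists_le1_le[d [d0 d1 dt]]; exists d => //.
by rewrite expr2 -[leRHS]mulr1 ler_pM // ltW.
Qed.

Section OrthonormalBasis.
Context {K : numFieldType} {conj : K -> K} (hK : real_or_complex conj).
Context {H : hilbertType conj} {X : choiceType} {e : X -> H}.
Hypothesis he : orthonormal_basis e.
Implicit Types (u v w : H) (F G : {fset X}).

Lemma basis_ip x y : ip (e x) (e y) = (x == y)%:R.
Proof. by case: he. Qed.

Lemma basis_norm x : `|e x| = 1.
Proof.
apply/eqP; rewrite -(@eqrXn2 _ 2) // -(ipvv (conj := conj)) basis_ip eqxx.
by rewrite expr1n.
Qed.

Lemma basis_ip_sum F (c : X -> K) x :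
  ip (e x) (\sum_(y <- F) c y *: e y) = if x \in F then c x else 0.
Proof.
rewrite ip_sumr; have [xF|xF] := ifPn.
  rewrite (bigD1_seq x) ?fset_uniq //= ipZr basis_ip eqxx mulr1 big1 ?addr0 //.
  by move=> y yx; rewrite ipZr basis_ip eq_sym (negbTE yx) mulr0.
rewrite big_seq big1 // => y yF; rewrite ipZr basis_ip.
by case: eqP => [xy|]; [rewrite xy yF in xF | rewrite mulr0].
Qed.

Lemma basis_norm_sum F (c : X -> K) :
  `|\sum_(y <- F) c y *: e y| ^+ 2 = \sum_(y <- F) `|c y| ^+ 2.
Proof.
rewrite -ipvv (ip_suml hK) big_seq [RHS]big_seq; apply: eq_bigr => x xF.
by rewrite (ipZl hK) basis_ip_sum xF mulrC mul_conj.
Qed.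

Definition partial_proj F u := \sum_(x <- F) ip (e x) u *: e x.

Lemma partial_proj_coord F u x :
  ip (e x) (partial_proj F u) = if x \in F then ip (e x) u else 0.
Proof. exact: basis_ip_sum. Qed.

Lemma partial_proj_ortho F u (c : X -> K) :
  ip (u - partial_proj F u) (\sum_(x <- F) c x *: e x) = 0.
Proof.
rewrite ip_sumr big_seq big1 // => x xF.
by rewrite ipZr ipC ipBr partial_proj_coord xF subrr (conj0 hK) mulr0.
Qed.

Lemma partial_proj_normB F u :
  `|u| ^+ 2 = `|u - partial_proj F u| ^+ 2 + `|partial_proj F u| ^+ 2.
Proof.
by rewrite -(pythagoras hK) ?subrK // partial_proj_ortho.
Qed.

Lemma partial_proj_norm F u :
  `|partial_proj F u| ^+ 2 = \sum_(x <- F) `|ip (e x) u| ^+ 2.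
Proof. exact: basis_norm_sum. Qed.

Lemma bessel F u : \sum_(x <- F) `|ip (e x) u| ^+ 2 <= `|u| ^+ 2.
Proof. by rewrite -partial_proj_norm [leRHS](partial_proj_normB F) lerDr exprn_ge0. Qed.

Lemma partial_proj_best F u (c : X -> K) :
  `|u - partial_proj F u| <= `|u - \sum_(x <- F) c x *: e x|.
Proof.
rewrite -(@ler_pXn2r _ 2) ?nnegrE //.
have -> : u - \sum_(x <- F) c x *: e x = (u - partial_proj F u)
  + \sum_(x <- F) (ip (e x) u - c x) *: e x.
  under [in RHS]eq_bigr do rewrite scalerBl.
  by rewrite sumrB addrA subrK.
by rewrite (pythagoras hK (partial_proj_ortho _ _ _)) lerDl exprn_ge0.
Qed.

Lemma lin_span_finite (J : set X) u : lin_span (e @` J) u ->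
  exists2 F, [set` F] `<=` J & u = partial_proj F u.
Proof.
case=> n [c [b [hb ->]]].
have hx i : {x | J x & e x = b i} by apply: cid2; exact: hb.
pose s := [seq (let: exist2 x _ _ := hx i in x) | i : 'I_n].
exists [fset x in s]%fset.
  move=> x /=; rewrite inE => /mapP[i _ ->]; by case: (hx i).
(* Several [b i] may be the same basis vector. Expanding the coordinates and exchanging the sums
   reduces the claim to one [b i] at a time, each of which is its own projection. *)
rewrite /partial_proj (eq_bigr (fun x => \sum_i (c i * ip (e x) (b i)) *: e x)).
  rewrite exchange_big /=; apply: eq_bigr => i _.
  have [x xs xb] : exists2 x, x \in [fset x in s]%fset & e x = b i.
    exists (let: exist2 x _ _ := hx i in x); last by case: (hx i).
    by rewrite inE; apply/mapP; exists i => //; rewrite mem_enum.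
  rewrite (bigD1_seq x) ?fset_uniq //= -xb basis_ip eqxx mulr1 big1 ?addr0 //.
  by move=> y yx; rewrite basis_ip (negbTE yx) mulr0 scale0r.
move=> x _; rewrite ip_sumr scaler_suml; apply: eq_bigr => i _.
by rewrite ipZr.
Qed.

Lemma closureP (S : set H) u :
  closure S u <-> forall eps, 0 < eps -> exists2 z, S z & `|u - z| < eps.
Proof.
split=> [Su eps eps0|h B /nbhs_ballP[eps /= eps0 uB]].
  have [z [Sz uz]] := Su _ (nbhsx_ballx u eps eps0).
  by exists z => //; move: uz; rewrite -ball_normE.
have [z Sz uz] := h _ eps0; exists z; split => //; apply: uB.
by rewrite -ball_normE.
Qed.

Lemma range_span_dense u : closure (lin_span (range e)) u.
Proof.
apply/closureP => eps eps0.
have [_ d] := he.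
have [||z [zu zS]] := d (ball u eps)^°.
- by exists u; exact: nbhsx_ballx.
- exact: open_interior.
by exists z => //; have /interior_subset := zu; rewrite -ball_normE.
Qed.

Lemma partial_proj_eqJ (J : set X) F u :
  (forall x, ~ J x -> ip (e x) u = 0) ->
  exists2 G, [set` G] `<=` J & partial_proj G u = partial_proj F u.
Proof.
move=> uJ; exists [fset x in F | `[< J x >]]%fset.
  by move=> x /=; rewrite !inE => /andP[_ /asboolP].
apply: big_fset_incl => [|x xF]; first exact: fset_sub.
rewrite !inE xF /= => /asboolP nJ.
by rewrite uJ ?scale0r.
Qed.

Lemma partial_proj_approx u eps : 0 < eps ->
  exists F, `|u - partial_proj F u| < eps.
Proof.
move=> eps0; have /closureP/(_ eps eps0)[z /lin_span_finite[F _ ->] uz] :=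
  @range_span_dense u.
(* The approximant from the span is supported on [F], and the projection of [u] onto that support is
   at least as close to [u]. *)
by exists F; apply: le_lt_trans uz; exact: partial_proj_best.
Qed.

(** A combination over [F] is one over [G] with zero coefficients added, so it cannot beat the best
    approximation over [G]. *)
Lemma partial_proj_mono F G u : (F `<=` G)%fset ->
  `|u - partial_proj G u| <= `|u - partial_proj F u|.
Proof.
move=> FG; suff -> : partial_proj F u =
    \sum_(x <- G) (if x \in F then ip (e x) u else 0) *: e x.
  exact: partial_proj_best.
rewrite /partial_proj.
rewrite big_seq (eq_bigr (fun x => (if x \in F then ip (e x) u else 0) *: e x)).
  rewrite -big_seq; apply: big_fset_incl => // x _ /negbTE ->.
  by rewrite scale0r.
by move=> x ->.
Qed.

Lemma partial_proj_approx_seq (s : seq H) eps : 0 < eps ->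
  exists F, forall u, u \in s -> `|u - partial_proj F u| < eps.
Proof.
move=> eps0; elim: s => [|u s [F hF]]; first by exists fset0.
have [G hG] := partial_proj_approx u eps0.
exists (F `|` G)%fset => v; rewrite inE => /predU1P[->|/hF].
  by apply: le_lt_trans hG; apply/partial_proj_mono/fsubsetUr.
by apply: le_lt_trans; apply/partial_proj_mono/fsubsetUl.
Qed.

Lemma coord_inj u v : (forall x, ip (e x) u = ip (e x) v) -> u = v.
Proof.
move=> uv; apply/eqP; rewrite -subr_eq0 -normr_le0; apply: le_epsP => eps eps0.
have [F] := partial_proj_approx (u - v) eps0.
rewrite /partial_proj big1 ?subr0 ?add0r => [/ltW //|x _].
by rewrite ipBr uv subrr scale0r.
Qed.

(** The half of Parseval that bounds norms by coordinates, for finitely many vectors at once. It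
    lets double sums of squared matrix entries be estimated in either order with finite sums
    only. *)
Lemma norm_le_coords (I : eqType) (s : seq I) (u : I -> H) M :
  (forall F, \sum_(i <- s) \sum_(x <- F) `|ip (e x) (u i)| ^+ 2 <= M) ->
  \sum_(i <- s) `|u i| ^+ 2 <= M.
Proof.
move=> hM; apply: le_epsP => eps eps0.
(* Each of the [size s] vectors may lose [eps / (size s).+1]; the successor keeps the quotient
   meaningful for an empty list. *)
have n0 : 0 < ((size s).+1%:R : K) by rewrite ltr0n.
have [d d0 dd] := sqr_small (divr_gt0 eps0 n0).
have [F hF] := partial_proj_approx_seq (map u s) d0.
under eq_bigr do rewrite (partial_proj_normB F) partial_proj_norm.
rewrite big_split /= addrC lerD //.
have : \sum_(i <- s) `|u i - partial_proj F (u i)| ^+ 2 <=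
    \sum_(i <- s) eps / (size s).+1%:R.
  rewrite big_seq [leRHS]big_seq; apply: ler_sum => i si; apply: le_trans dd.
  by rewrite ler_pXn2r ?nnegrE ?(ltW d0) // ltW // hF // map_f.
move/le_trans; apply; rewrite big_const_seq count_predT iter_addr_0 -[_ *+ size s]mulr_natr.
rewrite mulrAC ler_pdivrMr // ler_wpM2l ?(ltW eps0) //.
by rewrite ler_nat.
Qed.

Lemma coord_le_norm (M : K) (u : H) :
  (forall F : {fset X}, \sum_(x <- F) `|ip (e x) u| ^+ 2 <= M) ->
  `|u| ^+ 2 <= M.
Proof.
move=> hM; have := @norm_le_coords _ [:: tt] (fun=> u) M.
by rewrite big_seq1; apply => F; rewrite big_seq1.
Qed.

End OrthonormalBasis.

(** * Riesz-Fischer: square-summable families are coordinates of vectors *)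

Section RieszFischer.
Context {K : numFieldType} {conj : K -> K} (hK : real_or_complex conj).
Context {X : choiceType}.
Implicit Types (c : X -> K) (F G : {fset X}).

(** Otherwise every finite set could be enlarged so as to gain more than [eps], and enlarging it
    [n > M / eps] times would exceed the bound [M]. *)
Lemma square_summable_tail c (M : K) :
    (forall F, \sum_(x <- F) `|c x| ^+ 2 <= M) ->
  forall eps, 0 < eps -> exists F, forall G, (F `<=` G)%fset ->
    \sum_(x <- (G `\` F)%fset) `|c x| ^+ 2 <= eps.
Proof.
move=> hM eps eps0; apply: contrapT => /forallNP h.
have [n Mn] := archi hK (M / eps).
have {Mn} Mn : M < n%:R * eps.
  rewrite -ltr_pdivrMr //; apply: le_lt_trans Mn; apply: real_ler_norm.
  apply: ger0_real; apply: divr_ge0; last exact: ltW.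
  by apply: le_trans (hM fset0); rewrite big_seq_fset0.
suff [F hF] : exists F, n%:R * eps <= \sum_(x <- F) `|c x| ^+ 2.
  by have := lt_le_trans Mn (le_trans hF (hM F)); rewrite ltxx.
elim: n {Mn} => [|n [F hF]]; first by exists fset0; rewrite big_seq_fset0 mul0r.
have /existsNP[G /not_implyP[FG /negP]] := h F.
have Sr : \sum_(x <- (G `\` F)%fset) `|c x| ^+ 2 \is Num.real.
  by apply: ger0_real; apply: sumr_ge0 => x _; exact: exprn_ge0.
rewrite -(real_ltNge (gtr0_real eps0) Sr).
move=> /ltW hG; exists G.
rewrite -natr1 mulrDl mul1r (big_fsetID _ (mem F)) /= lerD //.
  rewrite (le_trans hF) // le_eqVlt; apply/orP; left; apply/eqP.
  apply: eq_fbigl => x; rewrite !inE andbC; case xF: (x \in F) => //=.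
  by rewrite (fsubsetP FG).
rewrite (le_trans hG) // le_eqVlt; apply/orP; left; apply/eqP.
by apply: eq_fbigl => x; rewrite !inE andbC.
Qed.

Context {H : hilbertType conj} {e : X -> H}.
Hypothesis he : orthonormal_basis e.

Lemma basis_sumB c F G : (F `<=` G)%fset ->
  \sum_(x <- G) c x *: e x - \sum_(x <- F) c x *: e x =
  \sum_(x <- (G `\` F)%fset) c x *: e x.
Proof.
move=> FG; apply/eqP; rewrite subr_eq; apply/eqP.
rewrite (big_fsetID _ (mem F)) /= addrC; congr (_ + _).
  by apply: eq_fbigl => x; rewrite !inE andbC.
apply: eq_fbigl => x; rewrite !inE andbC; case xF: (x \in F) => //=.
by rewrite (fsubsetP FG).
Qed.

Lemma riesz_fischer c (M : K) :
    (forall F, \sum_(x <- F) `|c x| ^+ 2 <= M) ->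
  exists u : H, forall x, ip (e x) u = c x.
Proof.
move=> hM; pose s F := \sum_(x <- F) c x *: e x.
(* The net of partial sums indexed by finite sets under inclusion, presented as a filter; its limit
   is the unordered sum. *)
pose FF := filter_from [set: {fset X}] (fun A => s @` [set B | (A `<=` B)%fset]).
have pF : ProperFilter FF.
  apply: filter_from_proper; last by move=> A _; exists (s A), A => /=.
  apply: filter_from_filter; first by exists fset0.
  move=> A B _ _; exists (A `|` B)%fset => //= _ [C /= ABC <-].
  move: ABC; rewrite fsubUset => /andP[AC BC].
  by split; exists C.
have cF : cauchy FF.
  apply: cauchy_exP => eps eps0.
  (* The tail estimate is a weak inequality while balls are strict, hence the half. *)
  have e20 : 0 < eps / 2 by rewrite divr_gt0.
  have [F hF] := square_summable_tail hM (exprn_gt0 2 e20).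
  exists (s F), F => // _ [G /= FG <-].
  rewrite -ball_normE /= distrC /s basis_sumB //.
  apply: (@le_lt_trans _ _ (eps / 2)); last first.
    by rewrite ltr_pdivrMr // ltr_pMr // ltr1n.
  by rewrite -(@ler_pXn2r _ 2) ?nnegrE ?(ltW e20) // (basis_norm_sum hK he) hF.
have [u hu] : exists u : H, FF --> u by apply/cvg_ex/cauchy_cvgP.
exists u => x; apply/eqP; rewrite -subr_eq0 -normr_le0.
apply: le_epsP => eps eps0; rewrite add0r.
have [F _ hF] := hu _ (nbhsx_ballx u eps eps0).
(* Once [x] belongs to the index set, the [x]-th coordinate of the partial sum is exactly [c x]. *)
pose G := (x |` F)%fset.
have /= : ball u eps (s G) by apply: hF; exists G => //=; exact: fsubsetUr.
rewrite -ball_normE /= => /ltW; apply: le_trans.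
have -> : c x = ip (e x) (s G) by rewrite /s basis_ip_sum // fset1U1.
rewrite -ipBr (le_trans (cauchy_schwarz hK _ _)) // basis_norm // mul1r //.
Qed.

End RieszFischer.

Section BoundedOperators.
Context {K : numFieldType} {conj : K -> K} (hK : real_or_complex conj).
Implicit Types H G : hilbertType conj.

Lemma bounded_opP H G (A : H -> G) : bounded_op A <->
  linear A /\ exists2 M, 0 <= M & forall u, `|A u| <= M * `|u|.
Proof.
split=> -[lA].
  move=> cA; split => //.
  pose f : {linear H -> G} := HB.pack A (GRing.isLinear.Build _ _ _ _ A lA).
  have /linear_boundedP := @continuous_linear_bounded _ _ _ 0 f (cA 0).
  case/pinfty_ex_gt0 => M M0 hM; exists M => //; exact: ltW.
case=> M M0 hM; split => //.
pose f : {linear H -> G} := HB.pack A (GRing.isLinear.Build _ _ _ _ A lA).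
apply: (@bounded_linear_continuous _ _ _ f); apply/linear_boundedP.
near=> r => x; apply: le_trans (hM x) _; apply: ler_wpM2r => //.
by near: r; apply: nbhs_pinfty_ge; exact: ger0_real.
Unshelve. all: by end_near. Qed.

End BoundedOperators.

(** * Bounded and Hilbert-Schmidt operators *)

Section LinearMaps.
Context {K : numFieldType} {V W : lmodType K} {A : V -> W}.
Hypothesis lA : linear A.

Lemma linfD u v : A (u + v) = A u + A v.
Proof. by have := lA 1 u v; rewrite !scale1r. Qed.

Lemma linf0 : A 0 = 0.
Proof. by apply: (addrI (A 0)); rewrite -linfD !addr0. Qed.

Lemma linfZ a u : A (a *: u) = a *: A u.
Proof. by rewrite -[a *: u]addr0 lA linf0 addr0. Qed.

Lemma linfB u v : A (u - v) = A u - A v.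
Proof. by rewrite -scaleN1r linfD linfZ scaleN1r. Qed.

Lemma linf_sum I (r : seq I) P (F : I -> V) :
  A (\sum_(i <- r | P i) F i) = \sum_(i <- r | P i) A (F i).
Proof. exact: (big_morph A linfD linf0). Qed.

End LinearMaps.

Section Operators.
Context {K : numFieldType} {conj : K -> K} (hK : real_or_complex conj).
Implicit Types H G L : hilbertType conj.

Lemma bounded_linear H G (A : H -> G) : bounded_op A -> linear A.
Proof. by case. Qed.

Lemma bounded_bound H G (A : H -> G) : bounded_op A ->
  exists2 M, 0 <= M & forall u, `|A u| <= M * `|u|.
Proof. by case/bounded_opP. Qed.

Lemma bounded_comp H G L (A : G -> L) (B : H -> G) :
  bounded_op A -> bounded_op B -> bounded_op (A \o B).
Proof.
move=> /bounded_opP[lA [M M0 hM]] /bounded_opP[lB [N N0 hN]].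
apply/bounded_opP; split; first by move=> a u v /=; rewrite lB lA.
exists (M * N); first exact: mulr_ge0.
move=> u /=; apply: le_trans (hM _) _.
by rewrite -mulrA ler_wpM2l.
Qed.

Lemma bounded_scale H G (c : K) (A : H -> G) :
  bounded_op A -> bounded_op (fun u => c *: A u).
Proof.
move=> /bounded_opP[lA [M M0 hM]].
apply/bounded_opP; split.
  by move=> a u v; rewrite lA scalerDr !scalerA mulrC.
exists (`|c| * M); first exact: mulr_ge0.
by move=> u /=; rewrite normrZ -mulrA ler_wpM2l.
Qed.

Lemma bounded_sub H G (A B : H -> G) :
  bounded_op A -> bounded_op B -> bounded_op (fun u => A u - B u).
Proof.
move=> /bounded_opP[lA [M M0 hM]] /bounded_opP[lB [N N0 hN]].
apply/bounded_opP; split.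
  by move=> a u v; rewrite lB lA scalerBr opprD addrACA.
exists (M + N); first exact: addr_ge0.
by move=> u /=; rewrite (le_trans (ler_normB _ _)) // mulrDl lerD.
Qed.

Lemma bounded_outer H (d : H) : bounded_op (outer d).
Proof.
apply/bounded_opP; split.
  by move=> a u v; rewrite /outer ipDr ipZr scalerDl scalerA.
exists (`|d| * `|d|); first exact: mulr_ge0.
move=> u; rewrite /outer normrZ mulrAC ler_wpM2r //.
exact: cauchy_schwarz.
Qed.

Section OneBasis.
Context {H : hilbertType conj} {X : choiceType} {e : X -> H}.
Hypothesis he : orthonormal_basis e.

(** [phi] vanishes on every finite projection of [u], so [phi u] is at most [M] times the
    approximation error. Dividing by [M + 1] covers [M = 0]. *)
Lemma functional_eq0 (phi : H -> K) (M : K) :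
    (forall a u v, phi (a *: u + v) = a * phi u + phi v) ->
    0 <= M -> (forall u, `|phi u| <= M * `|u|) ->
  (forall x, phi (e x) = 0) -> forall u, phi u = 0.
Proof.
move=> lp M0 hM p0 u.
have lphi : linear (phi : H -> K^o) by [].
apply/eqP; rewrite -normr_le0; apply: le_epsP => eps eps0; rewrite add0r.
have M1 : 0 < M + 1 by rewrite ltr_wpDl.
have [F] := partial_proj_approx hK he u (divr_gt0 eps0 M1).
rewrite ltr_pdivlMr // => /ltW; apply: le_trans.
have -> : phi u = phi (u - partial_proj (e := e) F u).
  rewrite (linfB lphi) (linf_sum lphi) big1 ?subr0 // => x _.
  by rewrite (linfZ lphi) p0 scaler0.
rewrite (le_trans (hM _)) // mulrC ler_wpM2l // lerDl //.
Qed.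

Lemma bounded_eq G (A B : H -> G) : bounded_op A -> bounded_op B ->
  (forall x, A (e x) = B (e x)) -> A = B.
Proof.
move=> bA bB AB; apply/funext => u; apply: ip_inj => w.
have bD := bounded_sub bA bB.
have [M M0 hM] := bounded_bound bD; have lD := bounded_linear bD.
apply/eqP; rewrite -subr_eq0 -ipBr; apply/eqP.
apply: (@functional_eq0 (fun u => ip w (A u - B u)) (`|w| * M)).
- by move=> a v v'; rewrite -ipZr -ipDr; congr ip; exact: lD.
- exact: mulr_ge0.
- move=> v; rewrite (le_trans (cauchy_schwarz hK _ _)) // -mulrA.
  by rewrite ler_wpM2l.
- by move=> x; rewrite AB subrr ip0r.
Qed.

(** Parseval as a comparison of two inner products whose expansions agree term by term, so that no
    infinite sum has to be formed. *)
Lemma parseval_eq (u v u' v' : H) :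
    (forall x, ip u (e x) * ip (e x) v = ip u' (e x) * ip (e x) v') ->
  ip u v = ip u' v'.
Proof.
move=> uv; apply/eqP; rewrite -subr_eq0 -normr_le0.
apply: le_epsP => eps eps0; rewrite add0r.
have M1 : 0 < `|u| + `|u'| + 1 by rewrite ltr_wpDl // addr_ge0.
have [F hF] := partial_proj_approx_seq hK he [:: v; v'] (divr_gt0 eps0 M1).
have -> : ip u v - ip u' v' = ip u (v - partial_proj (e := e) F v) -
    ip u' (v' - partial_proj (e := e) F v').
  have E : ip u (partial_proj (e := e) F v) =
      ip u' (partial_proj (e := e) F v').
    by rewrite !ip_sumr; apply: eq_bigr => x _; rewrite !ipZr mulrC uv mulrC.
  by rewrite !ipBr E opprB addrA subrK.
rewrite (le_trans (ler_normB _ _)) //.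
rewrite (@le_trans _ _ ((`|u| + `|u'|) * (eps / (`|u| + `|u'| + 1)))) //.
  rewrite mulrDl lerD // (le_trans (cauchy_schwarz hK _ _)) // ler_wpM2l // ltW //.
    by rewrite hF // inE eqxx.
  by rewrite hF // !inE eqxx orbT.
by rewrite mulrCA -[leRHS]mulr1 ler_wpM2l ?(ltW eps0) // ler_pdivrMr // mul1r lerDl.
Qed.

Lemma parseval_norm (u v : H) :
  (forall x, `|ip (e x) u| = `|ip (e x) v|) -> `|u| = `|v|.
Proof.
move=> uv; apply/eqP; rewrite -(@eqrXn2 _ 2) //; apply/eqP.
rewrite -!ipvv; apply: parseval_eq => x.
by rewrite [ip u _]ipC [ip v _]ipC ![conj _ * _]mulrC !(mul_conj hK) uv.
Qed.

(* For [z = \sum_(x <- F) conj <v, A e_x> e_x] one has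
   [|z|^2 = <v, A z> <= |v| M |z|], so the would-be coordinates of [A^* v] are
   square summable. *)
Lemma adjointP G (A : H -> G) : bounded_op A ->
  forall v u, ip (adjoint A v) u = ip v (A u).
Proof.
move=> bA v; have [M M0 hM] := bounded_bound bA; have lA := bounded_linear bA.
suff [w hw] : exists w, forall u, ip w u = ip v (A u).
  exact: (xgetPex 0 (ex_intro [set w | forall u, ip w u = ip v (A u)] w hw)).
have [|w hw] := @riesz_fischer _ _ hK _ _ e he
    (fun x => conj (ip v (A (e x)))) ((`|v| * M) ^+ 2).
  move=> F; set s := (leLHS).
  pose z := \sum_(x <- F) conj (ip v (A (e x))) *: e x.
  have zs : `|z| ^+ 2 = s by rewrite (basis_norm_sum hK he).
  have vz : ip v (A z) = s.
    rewrite (linf_sum lA) ip_sumr; apply: eq_bigr => x _.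
    by rewrite (linfZ lA) ipZr mulrC (mul_conj hK) (norm_conj hK).
  have sz : s <= `|v| * M * `|z|.
    rewrite -[s]ger0_norm -?zs ?exprn_ge0 // zs -vz.
    by rewrite (le_trans (cauchy_schwarz hK _ _)) // -mulrA ler_wpM2l.
  have [z0|z0] := eqVneq `|z| 0.
    by rewrite -zs z0 expr0n /= exprn_ge0 ?mulr_ge0.
  have zp : 0 < `|z| by rewrite lt_neqAle eq_sym z0 /=.
  rewrite -zs ler_pXn2r ?nnegrE ?mulr_ge0 //.
  by rewrite -(ler_pM2r zp) -expr2 zs.
exists w => u; apply/eqP; rewrite -subr_eq0; apply/eqP.
apply: (@functional_eq0 (fun u => ip w u - ip v (A u)) (`|w| + `|v| * M)).
- by move=> a u1 u2; rewrite lA !ipDr !ipZr mulrBr opprD addrACA.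
- by rewrite addr_ge0 ?mulr_ge0.
- move=> u1; rewrite (le_trans (ler_normB _ _)) // mulrDl lerD //.
    exact: cauchy_schwarz.
  by rewrite (le_trans (cauchy_schwarz hK _ _)) // -mulrA ler_wpM2l.
- by move=> x; rewrite ipC hw (conj_invol hK) subrr.
Qed.

Lemma adjointPr G (A : H -> G) : bounded_op A ->
  forall u v, ip u (adjoint A v) = ip (A u) v.
Proof. by move=> bA u v; rewrite ipC adjointP // -ipC. Qed.

Lemma bounded_adjoint G (A : H -> G) : bounded_op A -> bounded_op (adjoint A).
Proof.
move=> bA; have [M M0 hM] := bounded_bound bA.
apply/bounded_opP; split.
  by move=> a u v; apply: ip_inj => w; rewrite ipDr ipZr !adjointPr // ipDr ipZr.
exists M => // v; have [->|n0] := eqVneq `|adjoint A v| 0; first by rewrite mulr_ge0.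
have n1 : 0 < `|adjoint A v| by rewrite lt_neqAle eq_sym n0 /=.
rewrite -(ler_pM2r n1) -expr2 -ipvv adjointP //.
rewrite -[leLHS]ger0_norm; last by rewrite -adjointP // ipvv exprn_ge0.
rewrite (le_trans (cauchy_schwarz hK _ _)) // mulrAC mulrC ler_wpM2r //.
Qed.

End OneBasis.

Lemma adjoint_uniq H G (A : H -> G) (B : G -> H) :
  (forall v u, ip (B v) u = ip v (A u)) -> adjoint A = B.
Proof.
move=> hB; apply/funext => v.
have := xgetPex 0 (ex_intro [set w | forall u, ip w u = ip v (A u)] _ (hB v)).
rewrite /= -/(adjoint A v) => hA.
by apply: ip_injl => w; rewrite hA hB.
Qed.

End Operators.

Section HilbertSchmidt.
Context {K : numFieldType} {conj : K -> K} (hK : real_or_complex conj).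
Context {H G : hilbertType conj} {X Y : choiceType} {e : X -> H} {f : Y -> G}.
Hypotheses (he : orthonormal_basis e) (hf : orthonormal_basis f).

(* [D] is the adjoint of the operator [v |-> \sum_y <h_y, v> f_y]. *)
Lemma hilbert_schmidt_columns (h : Y -> H) (M : K) :
    (forall F : {fset Y}, \sum_(y <- F) `|h y| ^+ 2 <= M) ->
  exists D : G -> H, hilbert_schmidt f D /\ forall y, D (f y) = h y.
Proof.
move=> hM.
have M0 : 0 <= M by rewrite (le_trans _ (hM fset0)) // big_seq_fset0.
have hv v (F : {fset Y}) :
    \sum_(y <- F) `|ip (h y) v| ^+ 2 <= M * `|v| ^+ 2.
  apply: (@le_trans _ _ (\sum_(y <- F) `|h y| ^+ 2 * `|v| ^+ 2)).
    apply: ler_sum => y _; rewrite -exprMn ler_pXn2r ?nnegrE ?mulr_ge0 //.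
    exact: cauchy_schwarz.
  by rewrite -mulr_suml ler_wpM2r ?exprn_ge0.
have [E hE] := choice (fun v => riesz_fischer hK hf (hv v)).
have bE : bounded_op E.
  apply/bounded_opP; split.
    by move=> a u v; apply: (coord_inj hK hf) => y; rewrite ipDr ipZr !hE ipDr ipZr.
  exists (M + 1); first by rewrite addr_ge0.
  move=> v; rewrite -(@ler_pXn2r _ 2) ?nnegrE ?mulr_ge0 ?addr_ge0 // exprMn.
  have : `|E v| ^+ 2 <= M * `|v| ^+ 2.
    by apply: (coord_le_norm hK hf) => F; under eq_bigr do rewrite hE.
  move/le_trans; apply; rewrite ler_wpM2r ?exprn_ge0 //.
  rewrite expr2 mulrDl mul1r mulrDr mulr1 -addrA addrCA lerDl.
  by rewrite !addr_ge0 ?mulr_ge0.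
exists (adjoint E).
have Df y : adjoint E (f y) = h y.
  by apply: ip_inj => v; rewrite (adjointPr hK he) // ipC hE -ipC.
split=> //; split; first exact: (bounded_adjoint hK he).
by exists M => F; under eq_bigr do rewrite Df.
Qed.

Lemma hilbert_schmidt_adjoint (A : G -> H) :
  hilbert_schmidt f A -> hilbert_schmidt e (adjoint A).
Proof.
case=> bA [M hM]; split; first exact: (bounded_adjoint hK hf).
exists M => F; apply: (norm_le_coords hK hf) => F'; rewrite exchange_big /=.
apply: le_trans (hM F'); apply: ler_sum => y _.
apply: le_trans (bessel hK he F _); apply: ler_sum => x _.
by rewrite (adjointPr hK hf) // ipC (norm_conj hK).
Qed.

Lemma hilbert_schmidt_comp (L : hilbertType conj) (A : H -> L) (B : G -> H) :
  bounded_op A -> hilbert_schmidt f B -> hilbert_schmidt f (A \o B).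
Proof.
move=> bA [bB [N hN]]; split; first exact: bounded_comp.
have [M M0 hM] := bounded_bound bA.
exists (M ^+ 2 * N) => F; apply: (@le_trans _ _ (\sum_(y <- F) M ^+ 2 * `|B (f y)| ^+ 2)).
  apply: ler_sum => y _; rewrite -exprMn ler_pXn2r ?nnegrE ?mulr_ge0 //.
  exact: hM.
by rewrite -mulr_sumr ler_wpM2l ?exprn_ge0.
Qed.

End HilbertSchmidt.

(** * Existence of the transpose, the diagonal vector and the Schur product *)

Section HilbertSchmidtProducts.
Context {K : numFieldType} {conj : K -> K} (hK : real_or_complex conj).
Context {H G : hilbertType conj} {X Y : choiceType} {e : X -> H} {f : Y -> G}.
Hypotheses (he : orthonormal_basis e) (hf : orthonormal_basis f).

Lemma transposeP (A : G -> H) : hilbert_schmidt f A ->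
  hilbert_schmidt e (transpose f e A) /\
  forall x y, ip (transpose f e A (e x)) (f y) = ip (A (f y)) (e x).
Proof.
move=> [bA [M hM]].
have MA (F : {fset X}) (F' : {fset Y}) :
    \sum_(y <- F') \sum_(x <- F) `|ip (e x) (A (f y))| ^+ 2 <= M.
  by apply: le_trans (hM F'); apply: ler_sum => y _; exact: bessel.
(* Proved for every solution [B], since [transpose] is some solution picked by [xget] and not the
   witness constructed below. *)
have hB (B : H -> G) :
    (forall y x, ip (B (e x)) (f y) = ip (A (f y)) (e x)) ->
    forall F : {fset X}, \sum_(x <- F) `|B (e x)| ^+ 2 <= M.
  move=> BA F.
  apply: (norm_le_coords hK hf) => F'; rewrite exchange_big /=.
  apply: le_trans (MA F F'); apply: ler_sum => y _; apply: ler_sum => x _.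
  by rewrite ipC (norm_conj hK) BA ipC (norm_conj hK).
pose T := [set B : H -> G | bounded_op B /\
    forall y x, ip (B (e x)) (f y) = ip (A (f y)) (e x)].
suff [B TB] : exists B, T B.
  have [bT TA] : T (transpose f e A) := xgetPex (fun=> 0) (ex_intro T B TB).
  by split=> //; split=> //; exists M; exact: hB.
have hx x (F' : {fset Y}) :
    \sum_(y <- F') `|ip (e x) (A (f y))| ^+ 2 <= M.
  by have := MA [fset x]%fset F'; under eq_bigr do rewrite big_seq_fset1.
have [k hk] := choice (fun x => riesz_fischer hK hf (hx x)).
have [|B [[bB _] Bk]] := hilbert_schmidt_columns hK hf he (h := k) (M := M).
  move=> F; apply: (norm_le_coords hK hf) => F'; rewrite exchange_big /=.
  apply: le_trans (MA F F'); apply: ler_sum => y _; apply: ler_sum => x _.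
  by rewrite hk.
by exists B; split => // y x; rewrite Bk ipC hk -ipC.
Qed.

Lemma diag_vecP (A : H -> H) : hilbert_schmidt e A ->
  forall x, ip (e x) (diag_vec e A) = ip (e x) (A (e x)).
Proof.
move=> [bA [M hM]].
have [|d hd] := riesz_fischer hK he (c := fun x => ip (e x) (A (e x))) (M := M).
  move=> F; apply: le_trans (hM F); apply: ler_sum => x _.
  rewrite ler_pXn2r ?nnegrE // (le_trans (cauchy_schwarz hK _ _)) //.
  by rewrite (basis_norm he) mul1r.
exact: (xgetPex 0 (ex_intro [set d | forall x, ip (e x) d = ip (e x) (A (e x))] d hd)).
Qed.

(** The entries of [A] are bounded by its operator bound [M], so column [x] of the entrywise product
    has norm at most [M] times that of [B (e x)]. The columns are therefore square summable and
    define an operator. *)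
Lemma schurP (A B : H -> H) : bounded_op A -> hilbert_schmidt e B ->
  bounded_op (schur e A B) /\ forall x y, ip (e y) (schur e A B (e x)) =
    ip (e y) (A (e x)) * ip (e y) (B (e x)).
Proof.
move=> bA [bB [N hN]].
pose T := [set C : H -> H | bounded_op C /\ forall x y, ip (e y) (C (e x)) =
    ip (e y) (A (e x)) * ip (e y) (B (e x))].
suff [C TC] : exists C, T C.
  exact: (xgetPex (fun=> 0) (ex_intro T C TC) : T (schur e A B)).
have [M M0 hM] := bounded_bound bA.
have hx x (F : {fset X}) : \sum_(y <- F)
    `|ip (e y) (A (e x)) * ip (e y) (B (e x))| ^+ 2 <= M ^+ 2 * `|B (e x)| ^+ 2.
  apply: (@le_trans _ _ (\sum_(y <- F) M ^+ 2 * `|ip (e y) (B (e x))| ^+ 2)).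
    apply: ler_sum => y _; rewrite normrM exprMn ler_wpM2r ?exprn_ge0 //.
    rewrite ler_pXn2r ?nnegrE // (le_trans (cauchy_schwarz hK _ _)) //.
    by rewrite (basis_norm he) mul1r (le_trans (hM _)) // (basis_norm he) mulr1.
  by rewrite -mulr_sumr ler_wpM2l ?exprn_ge0 // bessel.
have [k hk] := choice (fun x => riesz_fischer hK he (hx x)).
have [|C [[bC _] Ck]] := hilbert_schmidt_columns hK he he (h := k) (M := M ^+ 2 * N).
  move=> F; apply: (@le_trans _ _ (\sum_(x <- F) M ^+ 2 * `|B (e x)| ^+ 2)).
    apply: ler_sum => x _; apply: (coord_le_norm hK he) => F'.
    by apply: le_trans (hx x F'); apply: ler_sum => y _; rewrite hk.
  by rewrite -mulr_sumr ler_wpM2l ?exprn_ge0.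
by exists C; split => // x y; rewrite Ck hk.
Qed.

End HilbertSchmidtProducts.

(** * Coordinate projections *)

Section CoordProj.
Context {K : numFieldType} {conj : K -> K} (hK : real_or_complex conj).
Context {H : hilbertType conj} {X : choiceType} {e : X -> H}.
Hypothesis he : orthonormal_basis e.
Variable J : set X.

Lemma sum_lin_span (F : {fset X}) (c : X -> K) : [set` F] `<=` J ->
  lin_span (e @` J) (\sum_(x <- F) c x *: e x).
Proof.
move=> FJ; exists (size (enum_fset F)), (fun i => c (tnth (in_tuple F) i)),
  (fun i => e (tnth (in_tuple F) i)); split.
  by move=> i; exists (tnth (in_tuple F) i) => //; apply: FJ => /=; exact: mem_tnth.
by rewrite big_tnth.
Qed.

(** Replaces the topological description of the closed span by a condition on coordinates.
    Coordinates are continuous; conversely, the finite projections of a vector vanishing off [J] use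
    only indices in [J]. *)
Lemma closure_spanP u : closure (lin_span (e @` J)) u <->
  forall x, ~ J x -> ip (e x) u = 0.
Proof.
split=> [/closureP uJ x nJ|uJ].
  apply/eqP; rewrite -normr_le0; apply: le_epsP => eps eps0; rewrite add0r.
  have [z /(lin_span_finite he)[F FJ zF] uz] := uJ _ eps0.
  have z0 : ip (e x) z = 0.
    rewrite zF (partial_proj_coord he); case: ifP => // xF.
    by case: nJ; exact: FJ.
  rewrite -[ip _ _]subr0 -z0 -ipBr (le_trans (cauchy_schwarz hK _ _)) //.
  by rewrite (basis_norm he) mul1r ltW.
apply/closureP => eps eps0.
have [F uF] := partial_proj_approx hK he u eps0.
have [G GJ GF] := partial_proj_eqJ F uJ.
exists (partial_proj (e := e) F u) => //.
by rewrite -GF; exact: sum_lin_span.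
Qed.

Lemma coord_projP u x :
  ip (e x) (coord_proj e J u) = if `[< J x >] then ip (e x) u else 0.
Proof.
pose c x := if `[< J x >] then ip (e x) u else 0.
have [|w hw] := riesz_fischer hK he (c := c) (M := `|u| ^+ 2).
  move=> F; apply: le_trans (bessel hK he F u); apply: ler_sum => y _.
  by rewrite /c; case: ifP => // _; rewrite normr0 expr0n exprn_ge0.
pose T := [set w | closure (lin_span (e @` J)) w /\
  forall v, closure (lin_span (e @` J)) v -> ip v (u - w) = 0].
have Tw : T w.
  split; first by apply/closure_spanP => y nJ; rewrite hw /c asboolF.
  (* Writing 0 as [ip 0 0] makes [parseval_eq] applicable: at each index either [u - w] or [v] has
     coordinate 0. *)
  move=> v /closure_spanP vJ; rewrite -[RHS](ip0r (0 : H)).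
  apply: (parseval_eq hK he) => y; rewrite ip0r mulr0 ipBr hw /c.
  case: asboolP => yJ; first by rewrite subrr mulr0.
  by rewrite ipC vJ // (conj0 hK) mul0r.
have [Pc Po] : T (coord_proj e J u) := xgetPex 0 (ex_intro T w Tw).
(* The chosen vector is known only through the two conditions in [T]: off [J] membership in the
   closed span decides, on [J] orthogonality is tested against [e x]. *)
case: asboolP => yJ; last by have /closure_spanP := Pc; apply.
apply/eqP; rewrite -subr_eq0 -opprB oppr_eq0 -ipBr; apply/eqP; apply: Po.
apply/closure_spanP => y nJ; rewrite (basis_ip he).
by case: eqP => // yx; case: nJ; rewrite yx.
Qed.

Lemma bounded_coord_proj : bounded_op (coord_proj e J).
Proof.
apply/bounded_opP; split.
  move=> a u v; apply: (coord_inj hK he) => x.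
  rewrite ipDr ipZr !coord_projP ipDr ipZr.
  by case: ifP => // _; rewrite mulr0 addr0.
exists 1 => // u; rewrite mul1r -(@ler_pXn2r _ 2) ?nnegrE //.
apply: (coord_le_norm hK he) => F; apply: le_trans (bessel hK he F u).
apply: ler_sum => y _; rewrite coord_projP.
by case: ifP => // _; rewrite normr0 expr0n exprn_ge0.
Qed.

Lemma coord_proj_sym u v : ip (coord_proj e J u) v = ip u (coord_proj e J v).
Proof.
apply: (parseval_eq hK he) => x; rewrite coord_projP ipC coord_projP.
by case: ifP => // _; [rewrite -ipC | rewrite (conj0 hK) mul0r mulr0].
Qed.

Lemma coord_proj_id u : (forall x, ~ J x -> ip (e x) u = 0) ->
  coord_proj e J u = u.
Proof.
move=> uJ; apply: (coord_inj hK he) => x; rewrite coord_projP.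
by case: asboolP => // /uJ ->.
Qed.

Lemma coord_proj_basis x : J x -> coord_proj e J (e x) = e x.
Proof.
move=> Jx; apply: coord_proj_id => y nJ; rewrite (basis_ip he).
by case: eqP => // yx; case: nJ; rewrite yx.
Qed.

End CoordProj.

Section FiniteRank.
Context {K : numFieldType}.

Definition indep (V : lmodType K) (k : nat) (b : 'I_k -> V) :=
  forall c : 'I_k -> K, \sum_i c i *: b i = 0 -> forall i, c i = 0.

(** If [k > n], the [k] by [n] coefficient matrix has a nonzero row in its left kernel, which is a
    nontrivial relation among the [b i]. *)
Lemma indep_le (V : lmodType K) k n (b : 'I_k -> V) (v : 'I_n -> V) :
    indep b -> (forall i, exists c : 'I_n -> K, b i = \sum_j c j *: v j) ->
  (k <= n)%N.
Proof.
move=> ib /choice[c hc]; rewrite leqNgt; apply/negP => nk.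
pose A : 'M[K]_(k, n) := \matrix_(i, j) c i j.
have : kermx A != 0.
  by rewrite -mxrank_eq0 mxrank_ker subn_eq0 -ltnNge (leq_ltn_trans (rank_leq_col A)).
case/rowV0Pn => r /sub_kermxP rA r0; case/negP: r0; apply/eqP/rowP => i.
rewrite mxE; apply: ib.
under eq_bigr do rewrite hc scaler_sumr.
rewrite exchange_big /= big1 // => j _.
under eq_bigr do rewrite scalerA.
rewrite -scaler_suml; have /rowP/(_ j) := rA; rewrite !mxE => s0.
by under eq_bigr => l _ do [have -> : c l j = A l j by rewrite mxE]; rewrite s0 scale0r.
Qed.

End FiniteRank.

(** * Finite rank *)

Lemma ex_maximal (P : nat -> Prop) (N : nat) :
  P 0%N -> (forall k, P k -> (k <= N)%N) -> exists2 k, P k & ~ P k.+1.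
Proof.
move=> P0 PN; apply: contrapT => h.
suff : P N.+1 by move/PN; rewrite ltnn.
elim: N.+1 => // k Pk; apply: contrapT => Pk1; apply: h; exists k => //.
Qed.

Section Rank.
Context {K : numFieldType} {conj : K -> K}.
Implicit Types H G : hilbertType conj.

Lemma indep_le_dim H (S : set H) n k (b : 'I_k -> H) :
  has_dim S n -> indep b -> (forall i, S (b i)) -> (k <= n)%N.
Proof.
by case=> v [_ ->] ib Sb; apply: (indep_le ib Sb).
Qed.

Lemma has_dim_uniq H (S : set H) m n : has_dim S m -> has_dim S n -> m = n.
Proof.
have le m' n' : has_dim S m' -> has_dim S n' -> (m' <= n')%N.
  move=> [b [ib Sb]] Sn; apply: (indep_le_dim Sn ib) => i.
  rewrite Sb; exists (fun j => (j == i)%:R).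
  by rewrite (bigD1 i) //= eqxx scale1r big1 ?addr0 // => j /negbTE ->; rewrite scale0r.
by move=> Sm Sn; apply/eqP; rewrite eqn_leq !le.
Qed.

Lemma rank_has_dim H G (A : H -> G) n :
  has_dim (range A) n -> rank A = Some n.
Proof.
move=> hn; rewrite /rank; have [m -> hm] := xgetPex None (ex_intro
  [set r | exists2 n, r = Some n & has_dim (range A) n] (Some n) (ex_intro2 _ _ n erefl hn)).
by rewrite (has_dim_uniq hm hn).
Qed.

Lemma rank_SomeP H G (A : H -> G) n : rank A = Some n -> has_dim (range A) n.
Proof.
rewrite /rank; case: xgetP => [r _ [m -> hm] [<-] //|//].
Qed.

Lemma rank_NoneP H G (A : H -> G) :
  rank A = None <-> forall n, ~ has_dim (range A) n.
Proof.
split=> [rN n /rank_has_dim|]; first by rewrite rN.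
by move=> h; rewrite /rank; case: xgetP => // r _ [n _ /h].
Qed.

Lemma indep_extend (V : lmodType K) k (b : 'I_k -> V) u :
    indep b -> ~ (exists c : 'I_k -> K, u = \sum_i c i *: b i) ->
  indep (fun i : 'I_k.+1 => if unlift ord_max i is Some j then b j else u).
Proof.
move=> ib nu c; rewrite big_ord_recr /= unlift_none.
under eq_bigr => i _.
  have -> : widen_ord (leqnSn k) i = lift ord_max i.
    by apply/val_inj; rewrite /= /bump leqNgt ltn_ord.
  rewrite liftK; over.
move=> s0.
have cm : c ord_max = 0.
  apply: contrapT => /eqP c0; apply: nu.
  exists (fun i => - (c ord_max)^-1 * c (lift ord_max i)).
  under eq_bigr do rewrite mulNr scaleNr -scalerA.
  rewrite sumrN -scaler_sumr; apply: (scalerI c0).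
  by rewrite scalerN scalerA divff // scale1r; apply/eqP; rewrite -addr_eq0 addrC s0.
move=> i; case: (unliftP ord_max i) => [j|] -> //.
by move: s0; rewrite cm scale0r addr0 => /ib.
Qed.

(** Independent families in the range have length at most [k]. One that cannot be extended exists,
    and it spans the range. *)
Lemma rank_le H G (A : H -> G) k (v : 'I_k -> G) : linear A ->
    (forall u, exists c : 'I_k -> K, A u = \sum_i c i *: v i) ->
  exists2 m, (m <= k)%N & rank A = Some m.
Proof.
move=> lA hv.
pose P m := exists b : 'I_m -> G, indep b /\ forall i, range A (b i).
have Pk m : P m -> (m <= k)%N.
  case=> b [ib rb]; apply: (indep_le (v := v) ib) => i.
  by have [u _ <-] := rb i; exact: hv.
have P0 : P 0%N by exists (fun=> 0); split=> [c _|] [].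
have [m [b [ib rb]] mmax] := ex_maximal P0 Pk.
exists m; first by apply: Pk; exists b.
apply: rank_has_dim; exists b; split => //.
apply/seteqP; split => w.
  move=> rw; apply: contrapT => nw; apply: mmax.
  exists (fun i => if unlift ord_max i is Some j then b j else w); split.
    exact: indep_extend.
  by move=> i; case: unlift.
case=> c ->; have /choice[a ha] : forall i, exists a, A a = b i.
  by move=> i; have [a _ <-] := rb i; exists a.
exists (\sum_i c i *: a i) => //; rewrite (linf_sum lA).
by apply: eq_bigr => i _; rewrite (linfZ lA) ha.
Qed.

End Rank.

Section Compression.
Context {K : numFieldType} {conj : K -> K} (hK : real_or_complex conj).
Context {H G : hilbertType conj} {X Y : choiceType} {e : X -> H} {f : Y -> G}.
Hypotheses (he : orthonormal_basis e) (hf : orthonormal_basis f).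
Variable J : set X.

Lemma bounded_compress_gram (C : G -> H) : bounded_op C ->
  bounded_op (compress e J (C \o adjoint C)).
Proof.
move=> bC; have bP := bounded_coord_proj hK he J.
exact: bounded_comp (bounded_comp bP (bounded_comp bC (bounded_adjoint hK hf bC))) bP.
Qed.

Lemma rank_le_rows (C : G -> H) (F : {fset X}) : bounded_op C -> J = [set` F] ->
  exists2 m, rank (compress e J (C \o adjoint C)) = Some m & (m <= size F)%N.
Proof.
move=> bC JF; set A := compress _ _ _.
have [|m mF rA] := rank_le (A := A) (v := fun i : 'I_(size F) => e (tnth (in_tuple F) i))
   (bounded_linear (bounded_compress_gram bC)); last by exists m.
move=> u; exists (fun i => ip (e (tnth (in_tuple F) i)) (A u)).
rewrite -(big_tnth _ _ F xpredT (fun x => ip (e x) (A u) *: e x)).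
apply: (coord_inj hK he) => x.
rewrite (basis_ip_sum he) (coord_projP hK he) JF; case: asboolP => /=.
  by move=> xF; rewrite xF.
by move/negP/negbTE => ->.
Qed.

End Compression.

(** * Finite orthonormal frames from finite rank *)

Section Frame.
Context {K : numFieldType} {conj : K -> K} (hK : real_or_complex conj).

Lemma orthonormal_sum (H : hilbertType conj) k (u : 'I_k -> H) (c : 'I_k -> K) i :
    (forall i j, ip (u i) (u j) = (i == j)%:R) ->
  ip (u i) (\sum_j c j *: u j) = c i.
Proof.
move=> uo; rewrite ip_sumr (bigD1 i) //= ipZr uo eqxx mulr1 big1 ?addr0 // => j ji.
by rewrite ipZr uo eq_sym (negbTE ji) mulr0.
Qed.

(** A nonzero residual of [p] after projection onto the [u i] stays in the subspace [S] and is
    orthogonal to all of them; normalized, it would lengthen a family chosen not to be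
    extendable. *)
Lemma frame_exists (H : hilbertType conj) (S : set H) (N : nat) :
    (forall a u v, S u -> S v -> S (a *: u + v)) ->
    (forall k (u : 'I_k -> H), (forall i j, ip (u i) (u j) = (i == j)%:R) ->
       (forall i, S (u i)) -> (k <= N)%N) ->
  exists k (u : 'I_k -> H), [/\ (k <= N)%N,
    forall i j, ip (u i) (u j) = (i == j)%:R &
    forall p, S p -> p = \sum_i ip (u i) p *: u i].
Proof.
move=> Sl SN.
pose P k := exists u : 'I_k -> H,
  (forall i j, ip (u i) (u j) = (i == j)%:R) /\ (forall i, S (u i)).
have PN k : P k -> (k <= N)%N by case=> u [uo uS]; exact: SN uo uS.
have P0 : P 0%N by exists (fun=> 0); split => -[].
have [k [u [uo uS]] kmax] := ex_maximal P0 PN.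
exists k, u; split => //; first by apply: PN; exists u.
move=> p Sp; apply: contrapT => hp; apply: kmax.
set r := p - \sum_i ip (u i) p *: u i.
have r0 : `|r| != 0 by rewrite normr_eq0 subr_eq0; apply/eqP.
have Sr : S r.
  rewrite /r -sumrN; elim/big_rec : _ => [|i q _ Sq]; first by rewrite addr0.
  by rewrite addrCA -scaleNr; apply: Sl.
(* [S] is assumed closed under combinations but not to contain 0; here 0 comes from [p] itself. *)
have S0 : S 0 by have := Sl (-1) p p Sp Sp; rewrite scaleN1r addNr.
have ur i : ip (u i) r = 0.
  by rewrite /r ipBr (orthonormal_sum _ i uo) subrr.
exists (fun i => if unlift ord_max i is Some j then u j else `|r|^-1 *: r); split.
  have nr : conj `|r|^-1 = `|r|^-1 by rewrite (conj_real hK) // rpredV normr_real.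
  move=> i j; case: (unliftP ord_max i) => [i'|] ->; case: (unliftP ord_max j) => [j'|] ->.
  - by rewrite uo (inj_eq lift_inj).
  - by rewrite ipZr ur mulr0 eq_sym (negbTE (neq_lift _ _)).
  - by rewrite (ipZl hK) ipC ur (conj0 hK) mulr0 (negbTE (neq_lift _ _)).
  - by rewrite (ipZl hK) ipZr nr ipvv eqxx mulrA -invfM -expr2 mulVf ?sqrf_eq0.
move=> i; case: unlift => [j|]; first exact: uS.
by rewrite -[_ *: _]addr0; apply: Sl.
Qed.

(* If [u_i = C^* z_i] with [z_i] supported on [J], a relation between the images
   of the [z_i] under the compression [T] of [C C^*] is one between the [u_i],
   since [<z, T z> = |C^* z|^2]. *)
Lemma rank_frame (H G : hilbertType conj) (X Y : choiceType) (e : X -> H)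
    (f : Y -> G) (he : orthonormal_basis e) (hf : orthonormal_basis f)
    (J : set X) (C : G -> H) n : bounded_op C ->
    rank (compress e J (C \o adjoint C)) = Some n ->
  exists k (u : 'I_k -> G), [/\ (k <= n)%N,
    forall i j, ip (u i) (u j) = (i == j)%:R &
    forall x, J x -> adjoint C (e x) = \sum_i ip (u i) (adjoint C (e x)) *: u i].
Proof.
move=> bC /rank_SomeP hn.
pose S := [set p | exists2 z, (forall x, ~ J x -> ip (e x) z = 0) & p = adjoint C z].
have lC' := bounded_linear (bounded_adjoint hK hf bC).
have [|k u uo uS|k [u [kn uo up]]] := @frame_exists G S n.
- move=> a _ _ [z zJ ->] [w wJ ->]; exists (a *: z + w); last by rewrite lC'.
  by move=> x nJ; rewrite ipDr ipZr zJ // wJ // mulr0 addr0.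
- have /choice[z hz] : forall i, exists z,
      (forall x, ~ J x -> ip (e x) z = 0) /\ u i = adjoint C z.
    by move=> i; have [z zJ uz] := uS i; exists z.
  have zJ i : coord_proj e J (z i) = z i.
    by apply: (coord_proj_id hK he); case: (hz i).
  have lT := bounded_linear (bounded_compress_gram hK he hf J bC).
  apply: (indep_le_dim (b := fun i => compress e J (C \o adjoint C) (z i)) hn); last first.
    by move=> i; exists (z i).
  move=> c s0 i.
  pose w := \sum_i c i *: z i.
  have Tw : compress e J (C \o adjoint C) w = 0.
    rewrite (linf_sum lT) -[RHS]s0; apply: eq_bigr => j _; exact: linfZ lT _ _.
  have Pw : coord_proj e J w = w.
    rewrite (linf_sum (bounded_linear (bounded_coord_proj hK he J))).
    apply: eq_bigr => j _.
    by rewrite (linfZ (bounded_linear (bounded_coord_proj hK he J))) zJ.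
  have Cw : adjoint C w = 0.
    apply/eqP; rewrite -normr_eq0 -sqrf_eq0 -ipvv.
    rewrite (adjointP hK hf) // -{1}Pw (coord_proj_sym hK he).
    have : coord_proj e J (C (adjoint C w)) = 0 by rewrite -[w in LHS]Pw; exact: Tw.
    by move=> ->; rewrite ip0r.
  have : ip (u i) (adjoint C w) = c i.
    rewrite (linf_sum lC') -[RHS](orthonormal_sum c i uo); congr ip.
    by apply: eq_bigr => j _; rewrite (linfZ lC'); case: (hz j) => _ ->.
  by rewrite Cw ip0r.
exists k, u; split => // x Jx; apply: up; exists (e x) => // y nJ.
by rewrite (basis_ip he); case: eqP => // yx; case: nJ; rewrite yx.
Qed.

End Frame.

(** * The inequality *)

(** Cauchy-Schwarz against the constant vector: with [r i] the norm of [a i], the sum of all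
    [(r i - r j) ^+ 2] is twice the difference of the two sides for [r]. *)
Lemma sqr_sum_le (K : numFieldType) k (a : 'I_k -> K) :
  `|\sum_i a i| ^+ 2 <= k%:R * \sum_i `|a i| ^+ 2.
Proof.
apply: (@le_trans _ _ ((\sum_i `|a i|) ^+ 2)).
  by rewrite ler_pXn2r ?nnegrE ?sumr_ge0 // ler_norm_sum.
set r := fun i => `|a i|.
have : 0 <= \sum_(i < k) \sum_(j < k) (r i - r j) ^+ 2.
  apply: sumr_ge0 => i _; apply: sumr_ge0 => j _.
  by rewrite real_exprn_even_ge0 // rpredB // normr_real.
have -> : \sum_(i < k) \sum_(j < k) (r i - r j) ^+ 2 =
    (k%:R * (\sum_i r i ^+ 2) - (\sum_i r i) ^+ 2) *+ 2.
  have -> : \sum_(i < k) \sum_(j < k) (r i - r j) ^+ 2 =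
      \sum_(i < k) \sum_(j < k) r i ^+ 2 - (\sum_(i < k) \sum_(j < k) r i * r j) *+ 2 +
      \sum_(i < k) \sum_(j < k) r j ^+ 2.
    rewrite -sumrMnl -sumrN -!big_split /=; apply: eq_bigr => i _.
    rewrite -sumrMnl -sumrN -!big_split /=; apply: eq_bigr => j _.
    by rewrite sqrrB.
  have -> : \sum_(i < k) \sum_(j < k) r i * r j = (\sum_i r i) ^+ 2.
    by rewrite expr2 mulr_suml; apply: eq_bigr => i _; rewrite mulr_sumr.
  have -> : \sum_(i < k) \sum_(j < k) r j ^+ 2 = k%:R * \sum_i r i ^+ 2.
    by rewrite sumr_const card_ord mulr_natl.
  have -> : \sum_(i < k) \sum_(j < k) r i ^+ 2 = k%:R * \sum_i r i ^+ 2.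
    by rewrite mulr_sumr; apply: eq_bigr => i _; rewrite sumr_const card_ord mulr_natl.
  by rewrite mulrnBl mulr2n addrAC.
by rewrite pmulrn_lge0 // subr_ge0.
Qed.

Section FiniteInequality.
Context {K : numFieldType} {conj : K -> K} (hK : real_or_complex conj).
Context {G : hilbertType conj} {X : choiceType} {Y : choiceType} {f : Y -> G}.
Hypothesis hf : orthonormal_basis f.
Variables (F : {fset X}) (w : X -> K) (p q qc : X -> G).
Hypothesis hqc : forall x y, ip (f y) (qc x) = conj (ip (f y) (q x)).
Variables (k : nat) (u : 'I_k -> G).
Hypothesis uo : forall i j, ip (u i) (u j) = (i == j)%:R.
Hypothesis up : forall x, x \in F -> p x = \sum_i ip (u i) (p x) *: u i.

(** In the application [p x], [q x] and [qc x] are [C1^* e_x], [C2^* e_x] and [C2^T e_x]. The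
    vectors [Nc i] are the rows of the matrix [M] in the frame [u], and [N i] is the coordinatewise
    conjugate of [Nc i]. *)
Let s x i := ip (u i) (p x).
Let N i := \sum_(x <- F) (w x * s x i) *: q x.
Let Nc i := \sum_(x <- F) conj (w x * s x i) *: qc x.

(** Expanding [p x] and [p x'] along the frame separates the dependence on [x] from that on [x'],
    and for each [i] the double sum becomes [ip (N i) (N i)]. This is also the Schur product
    theorem: the form is visibly nonnegative. *)
Lemma schur_form_sum :
  \sum_(x <- F) \sum_(x' <- F) conj (w x) * w x' * (ip (p x) (p x') * ip (q x) (q x'))
  = \sum_i `|N i| ^+ 2.
Proof.
under [RHS]eq_bigr => i _.
  rewrite -ipvv (ip_suml hK).
  under eq_bigr => x _.
    rewrite ip_sumr.
    under eq_bigr do rewrite (ipZl hK) ipZr (conjM hK).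
    over.
  over.
rewrite [RHS]exchange_big /= big_seq [RHS]big_seq; apply: eq_bigr => x xF.
rewrite [RHS]exchange_big /= big_seq [RHS]big_seq; apply: eq_bigr => x' xF'.
have -> : ip (p x) (p x') = \sum_i conj (s x i) * s x' i.
  rewrite {1}(up xF) (ip_suml hK); apply: eq_bigr => i _.
  by rewrite (ipZl hK).
rewrite mulr_suml mulr_sumr; apply: eq_bigr => i _.
by rewrite !mulrA; congr (_ * _); rewrite -!mulrA; congr (_ * _); rewrite mulrCA.
Qed.

Lemma diag_form_sum :
  \sum_(x <- F) conj (w x) * ip (p x) (qc x) = \sum_i ip (u i) (Nc i).
Proof.
under [RHS]eq_bigr do rewrite ip_sumr.
rewrite [RHS]exchange_big /= big_seq [RHS]big_seq; apply: eq_bigr => x xF.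
rewrite (up xF) (ip_suml hK) mulr_sumr; apply: eq_bigr => i _.
by rewrite (ipZl hK) ipZr (conjM hK) mulrA.
Qed.

Lemma schur_form_ge0 : 0 <=
  \sum_(x <- F) \sum_(x' <- F) conj (w x) * w x' * (ip (p x) (p x') * ip (q x) (q x')).
Proof. by rewrite schur_form_sum sumr_ge0 // => i _; rewrite exprn_ge0. Qed.

(** Cauchy-Schwarz twice: over the [k] frame indices, which produces the factor [k], and then in
    each [ip (u i) (Nc i)] with [u i] a unit vector. Conjugating coordinates preserves norms, so
    [Nc i] may be replaced by [N i]. *)
Lemma finite_trace_ineq : `|\sum_(x <- F) conj (w x) * ip (p x) (qc x)| ^+ 2 <=
  k%:R * \sum_(x <- F) \sum_(x' <- F)
    conj (w x) * w x' * (ip (p x) (p x') * ip (q x) (q x')).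
Proof.
rewrite diag_form_sum schur_form_sum (le_trans (sqr_sum_le _)) // ler_wpM2l //.
apply: ler_sum => i _; rewrite ler_pXn2r ?nnegrE //.
have -> : `|N i| = `|Nc i|.
  apply: (parseval_norm hK hf) => y; rewrite -(norm_conj hK (ip _ (N i))).
  suff -> : conj (ip (f y) (N i)) = ip (f y) (Nc i) by [].
  rewrite !ip_sumr (conj_sum hK); apply: eq_bigr => x _.
  by rewrite [RHS]ipZr hqc -(conjM hK) ipZr.
rewrite (le_trans (cauchy_schwarz hK _ _)) //.
have -> : `|u i| = 1; last by rewrite mul1r.
apply/eqP; rewrite -(@eqrXn2 _ 2) // -(ipvv (conj := conj)) uo eqxx.
by rewrite expr1n.
Qed.

End FiniteInequality.

(** * Passing from finitely supported vectors to their closure *)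

Section FormClosure.
Context {K : numFieldType} {conj : K -> K} (hK : real_or_complex conj).

Lemma conj_fixed_real x : conj x = x -> x \is Num.real.
Proof.
move=> xx; have := mul_conj hK x; rewrite xx -expr2 => /eqP.
by rewrite eqf_sqr => /orP[]/eqP ->; rewrite ?rpredN normr_real.
Qed.

(** Continuity of the quadratic form. Symmetry of [Q] makes its values real, without which closeness
    of two values would say nothing about their order in [K]. *)
Lemma form_ge0_closure (H : hilbertType conj) (Q : H -> H) (S : set H) w :
    bounded_op Q -> (forall u v, ip (Q u) v = ip u (Q v)) ->
    (forall z, S z -> 0 <= ip z (Q z)) -> closure S w ->
  0 <= ip w (Q w).
Proof.
move=> bQ sQ pQ /closureP cw; apply: (@le_epsP K) => eps eps0.
have [M M0 hM] := bounded_bound bQ; have lQ := bounded_linear bQ.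
(* The difference [R] of the two values splits into terms bounded by [d * M] times the norm of [w]
   and of [z]. Taking [d <= 1] bounds the norm of [z] by that of [w] plus 1, so [d * B] bounds
   [R]. *)
pose B := M * (`|w| + (`|w| + 1)).
have B1 : 0 < B + 1 by rewrite ltr_wpDl // mulr_ge0 // !addr_ge0.
have [d [d0 d1 dB]] := exists_le1_le (divr_gt0 eps0 B1).
have [z Sz wz] := cw _ d0.
set R := ip w (Q w) - ip z (Q z).
have Rr : R \is Num.real.
  by apply: conj_fixed_real; rewrite /R (conjB hK) -!ipC !sQ.
have RE : R = ip (w - z) (Q w) + ip z (Q (w - z)).
  by rewrite /R (ipBl hK) (linfB lQ) ipBr addrA subrK.
have zw : `|z| <= `|w| + 1.
  rewrite -[z](subKr w) (le_trans (ler_normB _ _)) // lerD2l (le_trans (ltW wz)) //.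
have Re : `|R| <= eps.
  apply: (@le_trans _ _ (d * B)).
    rewrite RE (le_trans (ler_normD _ _)) // /B mulrDr mulrDr lerD //.
      apply: le_trans (cauchy_schwarz hK _ _) _.
      by apply: ler_pM => //; exact: ltW.
    apply: le_trans (cauchy_schwarz hK _ _) _.
    rewrite mulrC mulrA [d * M]mulrC.
    apply: ler_pM => //; apply: le_trans (hM _) _.
    by apply: ler_wpM2l => //; exact: ltW.
  rewrite (le_trans (ler_wpM2r _ dB)) ?mulr_ge0 ?addr_ge0 //.
  rewrite mulrAC ler_pdivrMr // ler_wpM2l ?(ltW eps0) // lerDl //.
have -> : ip w (Q w) = R + ip z (Q z) by rewrite /R subrK.
rewrite addrAC addr_ge0 ?pQ // -lerBlDr sub0r lerNl; apply: le_trans Re.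
by rewrite -normrN; apply: real_ler_norm; rewrite rpredN.
Qed.

End FormClosure.

Section MainInequality.
Context {K : numFieldType} {conj : K -> K} (hK : real_or_complex conj).
Context {H G : hilbertType conj} {X Y : choiceType} {e : X -> H} {f : Y -> G}.
Hypotheses (he : orthonormal_basis e) (hf : orthonormal_basis f).
Variables C1 C2 : G -> H.
Hypotheses (hC1 : hilbert_schmidt f C1) (hC2 : hilbert_schmidt f C2).

(* In the basis [f], [A^T e_x] is the coordinatewise conjugate of [A^* e_x]. *)
Lemma conj_coord_transpose (A : G -> H) : hilbert_schmidt f A -> forall x y,
  ip (f y) (transpose f e A (e x)) = conj (ip (f y) (adjoint A (e x))).
Proof.
move=> hA x y; have [_ TA] := transposeP hK he hf hA.
by rewrite ipC TA (adjointPr hK hf) //; case: hA.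
Qed.

Let S := schur e (C1 \o adjoint C1) (C2 \o adjoint C2).
Let d := diag_vec e (C1 \o transpose f e C2).

Lemma gram_hilbert_schmidt (A : G -> H) : hilbert_schmidt f A ->
  hilbert_schmidt e (A \o adjoint A).
Proof.
move=> hA; apply: (hilbert_schmidt_comp (f := e)); first by case: hA.
exact: (hilbert_schmidt_adjoint hK he hf).
Qed.

Lemma schur_gramP : bounded_op S /\ forall x y, ip (e y) (S (e x)) =
  ip (adjoint C1 (e y)) (adjoint C1 (e x)) * ip (adjoint C2 (e y)) (adjoint C2 (e x)).
Proof.
have [bA _] := gram_hilbert_schmidt hC1.
have [bS hS] := schurP hK he bA (gram_hilbert_schmidt hC2).
split => // x y; rewrite hS /= !(adjointP hK hf) //.
- by case: hC2.
- by case: hC1.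
Qed.

Lemma schur_gram_sym u v : ip (S u) v = ip u (S v).
Proof.
have [bS hS] := schur_gramP.
suff SS : adjoint S = S by rewrite -{2}SS (adjointPr hK he bS).
apply: (bounded_eq hK he) => //; first exact: (bounded_adjoint hK he).
move=> x; apply: (coord_inj hK he) => y.
by rewrite (adjointPr hK he bS) ipC !hS (conjM hK) -!ipC.
Qed.

Lemma diag_transposeP x :
  ip (e x) d = ip (adjoint C1 (e x)) (transpose f e C2 (e x)).
Proof.
have [bC1 _] := hC1; rewrite (diag_vecP hK he) ?(adjointP hK hf) //.
apply: (hilbert_schmidt_comp (f := e)) => //.
by have [] := transposeP hK he hf hC2.
Qed.

(** In the basis [f] both sides expand into products of conjugated coordinates of [C1^* e_x] and
    [C2^* e_x], which is symmetric in the two operators. *)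
Lemma diag_transpose_swap x :
  ip (e x) d = ip (adjoint C2 (e x)) (transpose f e C1 (e x)).
Proof.
rewrite diag_transposeP; apply: (parseval_eq hK hf) => y.
by rewrite !conj_coord_transpose // -!ipC mulrC.
Qed.

Section FiniteVector.
Variables (F : {fset X}) (w : X -> K).
Let z := \sum_(x <- F) w x *: e x.

Lemma schur_form_finite : ip z (S z) = \sum_(x <- F) \sum_(x' <- F)
  conj (w x) * w x' * (ip (adjoint C1 (e x)) (adjoint C1 (e x')) *
    ip (adjoint C2 (e x)) (adjoint C2 (e x'))).
Proof.
have [bS hS] := schur_gramP.
rewrite (linf_sum (bounded_linear bS)) (ip_suml hK); apply: eq_bigr => x _.
rewrite ip_sumr; apply: eq_bigr => x' _.
by rewrite (linfZ (bounded_linear bS)) (ipZl hK) ipZr hS !mulrA.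
Qed.

Lemma diag_form_finite : ip z d = \sum_(x <- F) conj (w x) * ip (e x) d.
Proof. by rewrite (ip_suml hK); apply: eq_bigr => x _; rewrite (ipZl hK). Qed.

(** The compression to the finite set [F] has finite rank, so a frame is available even when the
    ranks over [J] are infinite. *)
Lemma schur_gram_ge0_finite : 0 <= ip z (S z).
Proof.
rewrite schur_form_finite.
have [bC1 _] := hC1; have [m rA _] := rank_le_rows hK he hf bC1 (erefl [set` F]).
have [k [u [_ _ up]]] := rank_frame hK he hf bC1 rA.
by apply: (schur_form_ge0 hK _ _ (u := u)) => x xF; exact: up.
Qed.

Lemma trace_ineq_finite (J : set X) n : [set` F] `<=` J ->
    rank (compress e J (C1 \o adjoint C1)) = Some n ->
  `|ip z d| ^+ 2 <= n%:R * ip z (S z).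
Proof.
move=> FJ rn; have [bC1 _] := hC1.
have [k [u [kn uo up]]] := rank_frame hK he hf bC1 rn.
apply: (@le_trans _ _ (k%:R * ip z (S z))); last first.
  by rewrite ler_wpM2r ?schur_gram_ge0_finite // ler_nat.
rewrite diag_form_finite schur_form_finite.
under eq_bigr do rewrite diag_transposeP.
apply: (finite_trace_ineq hK hf _ _ uo).
- by move=> x y; exact: conj_coord_transpose.
- by move=> x xF; apply: up; apply: FJ.
Qed.

End FiniteVector.
End MainInequality.

(** * The operator inequality *)

Section LowerBound.
Context {K : numFieldType} {conj : K -> K} (hK : real_or_complex conj).
Context {H G : hilbertType conj} {X Y : choiceType} {e : X -> H} {f : Y -> G}.
Hypotheses (he : orthonormal_basis e) (hf : orthonormal_basis f).

Lemma trace_ineq_finite_swap (C1 C2 : G -> H) (F : {fset X}) (w : X -> K)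
    (J : set X) n z :
    z = \sum_(x <- F) w x *: e x ->
    hilbert_schmidt f C1 -> hilbert_schmidt f C2 -> [set` F] `<=` J ->
    rank (compress e J (C2 \o adjoint C2)) = Some n ->
  `|ip z (diag_vec e (C1 \o transpose f e C2))| ^+ 2 <=
    n%:R * ip z (schur e (C1 \o adjoint C1) (C2 \o adjoint C2) z).
Proof.
move=> -> hC1 hC2 FJ rn.
have -> : diag_vec e (C1 \o transpose f e C2) = diag_vec e (C2 \o transpose f e C1).
  apply: (coord_inj hK he) => x.
  by rewrite (diag_transposeP hK he hf hC1 hC2) (diag_transpose_swap hK he hf hC2 hC1).
rewrite [leRHS](_ : _ = n%:R * ip (\sum_(x <- F) w x *: e x)
    (schur e (C2 \o adjoint C2) (C1 \o adjoint C1) (\sum_(x <- F) w x *: e x))); last first.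
  congr (_ * _); rewrite (schur_form_finite hK he hf hC1 hC2).
  rewrite (schur_form_finite hK he hf hC2 hC1).
  by apply: eq_bigr => x _; apply: eq_bigr => x' _; rewrite [X in _ * X = _]mulrC.
exact: (trace_ineq_finite hK he hf hC2 hC1 w FJ rn).
Qed.

Context {L : hilbertType conj} {Z : choiceType} {g : Z -> L}.
Hypothesis hg : orthonormal_basis g.
Variables (C1 C2 : G -> H) (C3 : L -> H).
Hypotheses (hC1 : hilbert_schmidt f C1) (hC2 : hilbert_schmidt f C2).
Hypothesis bC3 : bounded_op C3.
Let J := [set x | adjoint C3 (e x) <> 0].
Let S := schur e (C1 \o adjoint C1) (C2 \o adjoint C2).
Let d := diag_vec e (C1 \o transpose f e C2).

Lemma ip_outer (u v : H) : ip u (outer v u) = `|ip u v| ^+ 2.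
Proof. by rewrite /outer ipZr mulrC [ip v u]ipC (mul_conj hK). Qed.

Lemma outer_sym (u v w : H) : ip (outer w u) v = ip u (outer w v).
Proof. by rewrite /outer (ipZl hK) ipZr -ipC mulrC. Qed.

Lemma lower_bound_form (c : K) v :
  ip v ((adjoint C3 \o S \o C3) v - c *: (adjoint C3 \o outer d \o C3) v) =
  ip (C3 v) (S (C3 v)) - c * `|ip (C3 v) d| ^+ 2.
Proof. by rewrite ipBr ipZr /= !(adjointPr hK hg) // ip_outer. Qed.

(** Reduces the operator inequality to finitely supported vectors in [J]. A real [c] keeps [Q]
    self-adjoint, which is part of positivity and is used in the passage to the closure. *)
Lemma schur_lower_boundP (c : K) : c \is Num.real ->
    (forall (F : {fset X}) (w : X -> K) z, [set` F] `<=` J ->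
       z = \sum_(x <- F) w x *: e x -> c * `|ip z d| ^+ 2 <= ip z (S z)) ->
  schur_lower_bound e f C1 C2 C3 c.
Proof.
move=> cr hc; have [bS _] := schur_gramP hK he hf hC1 hC2.
have bC3' := bounded_adjoint hK hg bC3.
pose Q u := S u - c *: outer d u.
have bQ : bounded_op Q by apply: bounded_sub => //; apply/bounded_scale/bounded_outer.
have sQ u v : ip (Q u) v = ip u (Q v).
  rewrite /Q ipBr (ipBl hK) ipZr (ipZl hK) outer_sym (conj_real hK cr).
  by rewrite (schur_gram_sym hK he hf hC1 hC2).
have QE v : (adjoint C3 \o S \o C3) v - c *: (adjoint C3 \o outer d \o C3) v =
    adjoint C3 (Q (C3 v)).
  by rewrite (linfB (bounded_linear bC3')) (linfZ (bounded_linear bC3')).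
rewrite /schur_lower_bound /op_ge; split.
- apply: bounded_sub; first exact: bounded_comp (bounded_comp _ _) _.
  apply: bounded_scale; apply: bounded_comp => //; apply: bounded_comp => //.
  exact: bounded_outer.
- apply/esym/adjoint_uniq => v u.
  rewrite !QE (adjointPr hK hg) // -sQ -(adjointP hK hg) //.
- move=> v; rewrite QE (adjointPr hK hg) //.
  apply: (form_ge0_closure hK (S := lin_span (e @` J))) => //.
    move=> z /(lin_span_finite he)[F FJ zF].
    by rewrite ipBr ipZr ip_outer subr_ge0; exact: hc FJ zF.
  (* The coordinate of [C3 v] at [x] is [ip (adjoint C3 (e x)) v], so it vanishes off [J] by the
     definition of [J]. *)
  apply/(closure_spanP hK he) => x /contrapT Jx.
  by rewrite -(adjointP hK hg) // Jx (ip0l hK).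
Qed.

Lemma schur_lower_bound_gamma : schur_lower_bound e f C1 C2 C3 (gamma e J C1 C2).
Proof.
have ge0 F w := schur_gram_ge0_finite hK he hf hC1 hC2 F w.
(* For [n = 0] the inverse is 0 by convention and the claim is [0 <= b]. *)
have inv_le (n : nat) a b : 0 <= b -> a <= n%:R * b -> n%:R^-1 * a <= b :> K.
  case: n => [|n] b0 ab; first by rewrite invr0 mul0r.
  by rewrite ler_pdivrMl ?ltr0n.
have in1 n : rank (compress e J (C1 \o adjoint C1)) = Some n ->
    schur_lower_bound e f C1 C2 C3 n%:R^-1.
  move=> r1; apply: schur_lower_boundP; first by rewrite rpredV realn.
  move=> F w z FJ zE; apply: inv_le; first by rewrite zE; exact: ge0.
  by rewrite zE; exact: (trace_ineq_finite hK he hf hC1 hC2 w FJ r1).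
have in2 n : rank (compress e J (C2 \o adjoint C2)) = Some n ->
    schur_lower_bound e f C1 C2 C3 n%:R^-1.
  move=> r2; apply: schur_lower_boundP; first by rewrite rpredV realn.
  move=> F w z FJ zE; apply: inv_le; first by rewrite zE; exact: ge0.
  exact: (trace_ineq_finite_swap zE hC1 hC2 FJ r2).
rewrite /gamma /inv_min_rank.
case r1 : (rank _) => [m|]; case r2 : (rank _) => [n|]; try by [exact: in1|exact: in2].
  by rewrite /minn; case: ifP => _; [exact: in1|exact: in2].
(* Both ranks are infinite, so the coefficient is 0 and only positivity of the Schur form
   remains. *)
apply: schur_lower_boundP; first exact: real0.
by move=> F w z FJ ->; rewrite mul0r; exact: ge0.
Qed.

End LowerBound.

(** * Optimality of the coefficient *)

Definition in_size (r : option nat) (i : nat) : bool :=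
  if r is Some m then (i < m)%N else true.

(** Supplies the distinct indices along which the diagonal operators are built. An infinite [A]
    contains a copy of the naturals; for a finite one the hypothesis makes [r] finite and at most
    the cardinality. *)
Lemma sequence_in (T : choiceType) (A : set T) (r : option nat) : r <> Some 0%N ->
    (forall F : {fset T}, A = [set` F] -> exists2 m, r = Some m & (m <= size F)%N) ->
  exists x : nat -> T, (forall i, in_size r i -> A (x i)) /\
    (forall i j, in_size r i -> in_size r j -> x i = x j -> i = j).
Proof.
move=> r0 hA; have [/finite_fsetP[F AF]|/infiniteP/card_leP[f]] := pselect (finite_set A).
  have [m rm mF] := hA F AF; have m0 : (0 < m)%N.
    by case: m rm {mF} => // /r0.
  (* [nth] needs a default element; one exists because [F] has at least [m > 0] entries. *)
  have [x0 _] : exists x0 : T, True.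
    by case: (enum_fset F) (leq_trans m0 mF) => // x0; exists x0.
  rewrite rm; exists (nth x0 F); split=> [i /= im|i j /= im jm].
    by rewrite AF /=; apply: mem_nth; exact: leq_trans im mF.
  by move/eqP; rewrite nth_uniq ?fset_uniq ?(leq_trans _ mF) // => /eqP.
exists (fun i => set_val (f (to_setT i))); split => [i _|i j _ _ xij].
  exact: set_valP.
have fij : f (to_setT i) = f (to_setT j) by exact: val_inj xij.
by have := 'inj_f (in_setT (to_setT i)) (in_setT (to_setT j)) fij; case.
Qed.

(* [<z_i, v + t z_N>] is a nonzero polynomial in [t] for each [i <= N]. *)
Lemma nonvanishing {K : numFieldType} {conj : K -> K} (hK : real_or_complex conj)
    (H : hilbertType conj) (z : nat -> H) N :
  (forall i, (i < N)%N -> z i <> 0) ->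
  exists v, forall i, (i < N)%N -> ip (z i) v != 0.
Proof.
elim: N => [|N IH] hz; first by exists 0.
have [v hv] := IH (fun i iN => hz i (ltnW iN)).
have zN : ip (z N) (z N) != 0 by rewrite ipvv sqrf_eq0 normr_eq0; apply/eqP/hz.
pose q i : {poly K} := (ip (z i) v)%:P + 'X * (ip (z i) (z N))%:P.
have qE i t : (q i).[t] = ip (z i) (v + t *: z N).
  by rewrite /q !hornerE ipDr ipZr.
have q0 i : (i < N.+1)%N -> q i != 0.
  rewrite ltnS leq_eqVlt => /predU1P[->|/hv iN].
    apply/eqP => /(congr1 (fun p : {poly K} => p`_1)) /eqP.
    by rewrite /q coefD coefC coefXM coefC /= add0r coef0 (negbTE zN).
  apply/eqP => /(congr1 (fun p : {poly K} => p`_0)) /eqP.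
  by rewrite /q coefD coefC coefXM coef0 /= addr0 (negbTE iN).
pose p := \prod_(i < N.+1) q i.
have p0 : p != 0 by apply/prodf_neq0 => i _; exact: q0.
pose s : seq K := [seq j%:R | j <- iota 0 (size p)].
have us : uniq s.
  rewrite map_inj_uniq ?iota_uniq // => i j /eqP; rewrite eqr_nat => /eqP //.
have /allPn[t _ pt] : ~~ all (root p) s.
  apply/negP => rs; have := max_poly_roots p0 rs us.
  by rewrite size_map size_iota ltnn.
exists (v + t *: z N) => i iN; rewrite -qE.
move: pt; rewrite /root /p horner_prod => /prodf_neq0/(_ (Ordinal iN) isT).
by [].
Qed.

Lemma geometric_sum_le2 {K : numFieldType} (s : seq nat) : uniq s ->
  \sum_(i <- s) 2^-1 ^+ i <= 2 :> K.
Proof.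
move=> us; have [n sn] : exists n, forall i, i \in s -> (i < n)%N.
  by exists (\max_(i <- s) i).+1 => i si; rewrite ltnS (leq_bigmax_seq (F := id)).
have geo m : \sum_(i < m) 2^-1 ^+ i + 2 * 2^-1 ^+ m = 2 :> K.
  elim: m => [|m IH]; first by rewrite big_ord0 add0r expr0 mulr1.
  rewrite -[RHS]IH big_ord_recr /= -addrA; congr (_ + _).
  by rewrite exprS mulrA divff // mul1r mulr_natl mulr2n.
rewrite -[leRHS](geo n).
apply: (@le_trans _ _ (\sum_(i < n) 2^-1 ^+ i)); last first.
  by rewrite lerDl mulr_ge0 // exprn_ge0 // invr_ge0.
rewrite -(big_mkord xpredT (fun i => 2^-1 ^+ i : K)).
rewrite (perm_big [seq i <- index_iota 0 n | i \in s]); last first.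
  apply: uniq_perm => //; first by rewrite filter_uniq ?iota_uniq.
  move=> i; rewrite mem_filter mem_index_iota /= andbC.
  by case: (boolP (i \in s)) => [/sn ->|]; rewrite ?andbF.
rewrite big_filter [leRHS](bigID (mem s)) /= lerDl.
by apply: sumr_ge0 => i _; rewrite exprn_ge0 // invr_ge0.
Qed.

(** * Diagonal operators along two sequences of basis vectors *)

Section DiagonalOperators.
Context {K : numFieldType} {conj : K -> K} (hK : real_or_complex conj).
Context {H G : hilbertType conj} {X Y : choiceType} {e : X -> H} {f : Y -> G}.
Hypotheses (he : orthonormal_basis e) (hf : orthonormal_basis f).
Variables (I : pred nat) (x : nat -> X) (y : nat -> Y).
Hypothesis xI : forall i j, I i -> I j -> x i = x j -> i = j.
Hypothesis yI : forall i j, I i -> I j -> y i = y j -> i = j.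

Definition diagonal_op (a : nat -> K) (D : G -> H) : Prop :=
  (forall i, I i -> D (f (y i)) = a i *: e (x i)) /\
  (forall y', (forall i, I i -> y i <> y') -> D (f y') = 0).

(** Geometric decay is a convenient sufficient condition: it bounds the Hilbert-Schmidt sum by
    [M * 2]. *)
Lemma diagonal_op_exists (a : nat -> K) (M : K) :
    (forall i, `|a i| ^+ 2 <= M * 2^-1 ^+ i) ->
  exists2 D, hilbert_schmidt f D & diagonal_op a D.
Proof.
move=> aM.
have M0 : 0 <= M by rewrite (le_trans _ (_ : `|a 0%N| ^+ 2 <= M)) ?exprn_ge0 // -[M]mulr1 aM.
pose P y' := exists2 i, I i & y i = y'.
(* [idx] inverts [y] on its image; the value 0 elsewhere is arbitrary, as [h] vanishes there. *)
have /choice[idx idxP] : forall y', exists i, P y' -> I i /\ y i = y'.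
  move=> y'; have [[i Ii yi]|nP] := pselect (P y'); first by exists i.
  by exists 0%N.
pose h y' : H := if `[< P y' >] then a (idx y') *: e (x (idx y')) else 0.
have [|D [hD Dh]] := @hilbert_schmidt_columns _ _ hK _ _ _ _ _ _ he hf h (M * 2).
  move=> F; rewrite (eq_bigr (fun y' => if `[< P y' >] then `|a (idx y')| ^+ 2 else 0)).
    rewrite -big_mkcond /= -big_filter -(big_map idx xpredT (fun i => `|a i| ^+ 2)).
    apply: (@le_trans _ _ (\sum_(i <- [seq idx i | i <- F & `[< P i >]]) M * 2^-1 ^+ i)).
      by apply: ler_sum => i _.
    rewrite -mulr_sumr ler_wpM2l // geometric_sum_le2 //.
    rewrite map_inj_in_uniq ?filter_uniq ?fset_uniq // => y1 y2.
    rewrite !mem_filter => /andP[/asboolP/idxP[_ E1] _].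
    by case/andP=> /asboolP/idxP[_ E2] _ E; rewrite -E1 -E2 E.
  move=> y' _; rewrite /h; case: ifP => _; last by rewrite normr0 expr0n.
  by rewrite normrZ (basis_norm he) mulr1.
exists D => //; split => [i Ii|y' ny]; rewrite Dh /h.
  have Pi : P (y i) by exists i.
  have [Iidx /yI idxE] := idxP _ Pi.
  by rewrite asboolT // idxE.
by rewrite asboolF // => -[i Ii /(ny i Ii)].
Qed.

Section OneOperator.
Variables (a : nat -> K) (D : G -> H).
Hypotheses (bD : bounded_op D) (hD : diagonal_op a D).

Lemma adjoint_diagonal_op i : I i -> adjoint D (e (x i)) = conj (a i) *: f (y i).
Proof.
have [D1 D0] := hD.
move=> Ii; apply: (coord_inj hK hf) => y'; rewrite (adjointPr hK hf) // ipZr (basis_ip hf).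
have [[j Ij <-]|ny] := pselect (exists2 j, I j & y j = y'); last first.
  rewrite D0 => [|j Ij yj]; last by apply: ny; exists j.
  by rewrite (ip0l hK); case: eqP => [yi|_]; [case: ny; exists i | rewrite mulr0].
rewrite D1 // (ipZl hK) (basis_ip he).
case: eqP => [/xI -> //|xij]; first by rewrite eqxx.
case: eqP => [/yI yij|_]; last by rewrite !mulr0.
by case: xij; rewrite yij.
Qed.

Lemma adjoint_diagonal_op0 x' : (forall i, I i -> x i <> x') ->
  adjoint D (e x') = 0.
Proof.
have [D1 D0] := hD.
move=> nx; apply: (coord_inj hK hf) => y'; rewrite (adjointPr hK hf) // ip0r.
have [[j Ij <-]|ny] := pselect (exists2 j, I j & y j = y'); last first.
  by rewrite D0 ?(ip0l hK) // => j Ij yj; apply: ny; exists j.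
by rewrite D1 // (ipZl hK) (basis_ip he); case: eqP => [/(nx j Ij)|_] //; rewrite mulr0.
Qed.

End OneOperator.

(** Symmetry moves [Q] onto the basis vector, so every coordinate of [Q u] is read off from the
    values on the basis without expanding [u]. *)
Lemma diagonal_expand n (l : nat -> K) (Q : H -> H) :
    (forall i, (i < n)%N -> I i) ->
    (forall u v, ip (Q u) v = ip u (Q v)) -> (forall i, conj (l i) = l i) ->
    (forall i, (i < n)%N -> Q (e (x i)) = l i *: e (x i)) ->
    (forall x', (forall i, (i < n)%N -> x i <> x') -> Q (e x') = 0) ->
  forall u, Q u = \sum_(i < n) (l i * ip (e (x i)) u) *: e (x i).
Proof.
move=> In sQ lr Q1 Q0 u; apply: (coord_inj hK he) => x'.
rewrite -sQ ip_sumr.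
have [[j jn <-]|nx] := pselect (exists2 j, (j < n)%N & x j = x'); last first.
  have nx' i : (i < n)%N -> x i <> x' by move=> lin xi; apply: nx; exists i.
  rewrite Q0 // (ip0l hK) big1 // => i _; rewrite ipZr (basis_ip he).
  by case: eqP => [xi|]; [case: (nx' i) | rewrite mulr0].
rewrite Q1 // (ipZl hK) lr (bigD1 (Ordinal jn)) //= ipZr (basis_ip he) eqxx mulr1.
rewrite big1 ?addr0 // => i; rewrite -val_eqE /= => ij.
rewrite ipZr (basis_ip he); case: eqP => [xji|]; last by rewrite mulr0.
by move: ij; rewrite (xI _ _ xji) ?In ?eqxx.
Qed.

Variable J : set X.
Hypothesis xJ : forall i, I i -> J (x i).

Lemma compress_gram_sym (D : G -> H) : bounded_op D -> forall u v,
  ip (compress e J (D \o adjoint D) u) v = ip u (compress e J (D \o adjoint D) v).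
Proof.
move=> bD u v; rewrite /compress /= (coord_proj_sym hK he).
by rewrite -(adjointPr hK hf) // (adjointP hK hf) // -(coord_proj_sym hK he).
Qed.

(** In the finite case [A] has to be an initial segment, so that a basis of the range can be indexed
    by ['I_m]. In the infinite case any infinite set will do, given through arbitrarily long
    injective families. *)
Definition has_size (A : pred nat) (r : option nat) : Prop :=
  if r is Some m then forall i, A i = (i < m)%N
  else forall n, exists2 s : 'I_n -> nat, injective s & forall i, A (s i).

(** The compression is diagonal with eigenvalues the squared norms of the [a i], so the [e (x i)]
    with [a i] nonzero are independent elements of its range, and they span it when there are
    finitely many. *)
Lemma rank_diagonal_op (a : nat -> K) (D : G -> H) (A : pred nat) r :
    bounded_op D -> diagonal_op a D -> has_size A r ->
    (forall i, A i -> I i) -> (forall i, I i -> (a i == 0) = ~~ A i) ->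
  rank (compress e J (D \o adjoint D)) = r.
Proof.
move=> bD hD Ar AI aA; set T := compress _ _ _.
have bT : bounded_op T by exact: (bounded_compress_gram hK he hf).
have lT := bounded_linear bT.
have T1 i : I i -> T (e (x i)) = `|a i| ^+ 2 *: e (x i).
  move=> Ii; have Px := coord_proj_basis hK he (xJ Ii).
  rewrite /T /compress /= Px.
  rewrite (adjoint_diagonal_op bD hD) // (linfZ (bounded_linear bD)).
  have [-> // _] := hD; rewrite scalerA (linfZ (bounded_linear (bounded_coord_proj hK he J))).
  by rewrite Px mulrC (mul_conj hK).
have T0 x' : (forall i, I i -> x i <> x') -> T (e x') = 0.
  move=> nx; rewrite /T /compress /=.
  have lP := bounded_linear (bounded_coord_proj hK he J).
  have lD := bounded_linear bD.
  have lD' := bounded_linear (bounded_adjoint hK hf bD).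
  have [Jx|nJ] := pselect (J x').
    rewrite (coord_proj_basis hK he) // (adjoint_diagonal_op0 bD hD) //.
    by rewrite (linf0 lD) (linf0 lP).
  have -> : coord_proj e J (e x') = 0.
    apply: (coord_inj hK he) => x''; rewrite (coord_projP hK he) ip0r (basis_ip he).
    by case: asboolP => // Jx''; case: eqP => // xx; case: nJ; rewrite -xx.
  by rewrite (linf0 lD') (linf0 lD) (linf0 lP).
have rT i : A i -> range T (e (x i)).
  move=> Ai; exists ((`|a i| ^+ 2)^-1 *: e (x i)) => //.
  rewrite (linfZ lT) T1 ?AI // scalerA mulVf ?scale1r //.
  by rewrite sqrf_eq0 normr_eq0 aA ?AI // Ai.
have ind n (s : 'I_n -> nat) : injective s -> (forall i, A (s i)) ->
    indep (fun i => e (x (s i))).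
  move=> sinj sA c s0 i.
  rewrite -(orthonormal_sum (u := fun i => e (x (s i))) c i) ?s0 ?ip0r //.
  move=> j k; rewrite (basis_ip he); congr (nat_of_bool _)%:R.
  apply/eqP/eqP => [/xI/sinj -> //|-> //]; exact: AI.
case: r Ar => [m|] /= Ar.
  apply: rank_has_dim; exists (fun i : 'I_m => e (x i)); split.
    by apply: (ind m val val_inj) => i; rewrite Ar; exact: ltn_ord.
  apply/seteqP; split=> [_ [u _ <-]|_ [c ->]] /=.
    exists (fun i : 'I_m => `|a i| ^+ 2 * ip (e (x i)) u).
    apply: (diagonal_expand (l := fun i => `|a i| ^+ 2)).
    - by move=> i im; apply: AI; rewrite Ar.
    - exact: compress_gram_sym.
    - by move=> i; rewrite (conj_real hK) // rpredX ?normr_real.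
    - by move=> i im; apply/T1/AI; rewrite Ar.
    - move=> x' nx; have [[j Ij xj]|nx'] := pselect (exists2 j, I j & x j = x').
        have := aA j Ij; have [jm|mj] := ltnP j m; first by case: (nx j jm xj).
        by rewrite Ar ltnNge mj /= => /eqP aj; rewrite -xj T1 // aj normr0 expr0n scale0r.
      by apply: T0 => i Ii xi; apply: nx'; exists i.
  have /choice[b bE] : forall i : 'I_m, exists b, T b = e (x i).
    by move=> i; have [|b _ <-] := rT i; [rewrite Ar | exists b].
  exists (\sum_i c i *: b i) => //; rewrite (linf_sum lT); apply: eq_bigr => i _.
  by rewrite (linfZ lT) bE.
apply/rank_NoneP => n hn; have [s sinj sA] := Ar n.+1.
have := indep_le_dim hn (ind _ s sinj sA) (fun i => rT _ (sA i)).
by rewrite ltnn.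
Qed.

End DiagonalOperators.

(** * The two sides of the inequality for diagonal operators *)

Section DiagonalForms.
Context {K : numFieldType} {conj : K -> K} (hK : real_or_complex conj).
Context {H G : hilbertType conj} {X Y : choiceType} {e : X -> H} {f : Y -> G}.
Hypotheses (he : orthonormal_basis e) (hf : orthonormal_basis f).
Variables (I : pred nat) (x : nat -> X) (y : nat -> Y).
Hypothesis xI : forall i j, I i -> I j -> x i = x j -> i = j.
Hypothesis yI : forall i j, I i -> I j -> y i = y j -> i = j.
Variables (a b : nat -> K) (D1 D2 : G -> H) (N : nat).
Hypotheses (hD1 : hilbert_schmidt f D1) (hD2 : hilbert_schmidt f D2).
Hypothesis aD1 : diagonal_op (e := e) (f := f) I x y a D1.
Hypothesis bD2 : diagonal_op (e := e) (f := f) I x y b D2.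
Hypothesis NI : forall i, (i < N)%N -> I i.
Hypothesis abN : forall i, (N <= i)%N -> a i * b i = 0.

Let bnd1 : bounded_op D1. Proof. by case: hD1. Qed.
Let bnd2 : bounded_op D2. Proof. by case: hD2. Qed.

Lemma diag_vec_diagonal : diag_vec e (D1 \o transpose f e D2) =
  \sum_(i < N) (a i * b i) *: e (x i).
Proof.
apply: (coord_inj hK he) => x'; rewrite (diag_transposeP hK he hf hD1 hD2) ip_sumr.
have [[j Ij <-]|nx] := pselect (exists2 j, I j & x j = x'); last first.
  rewrite (adjoint_diagonal_op0 hK he hf bnd1 aD1) => [|i Ii xi]; last first.
    by apply: nx; exists i.
  rewrite (ip0l hK) big1 // => i _; rewrite ipZr (basis_ip he).
  case: eqP => [xi|_]; last by rewrite mulr0.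
  by case: nx; exists i => //; exact: NI.
rewrite (adjoint_diagonal_op hK he hf xI yI bnd1 aD1) // (ipZl hK) (conj_invol hK).
rewrite (conj_coord_transpose hK he hf hD2).
rewrite (adjoint_diagonal_op hK he hf xI yI bnd2 bD2) // ipZr (basis_ip hf) eqxx mulr1.
rewrite (conj_invol hK).
have other (i : 'I_N) : i != j :> nat -> ip (e (x j)) ((a i * b i) *: e (x i)) = 0.
  move=> ij; rewrite ipZr (basis_ip he); case: eqP => [xji|]; last by rewrite mulr0.
  by move: ij; rewrite (xI Ij (NI (ltn_ord i)) xji) eqxx.
have [jN|Nj] := ltnP j N.
  by rewrite (bigD1 (Ordinal jN)) //= ipZr (basis_ip he) eqxx mulr1 big1 ?addr0.
rewrite abN // big1 // => i _; apply: other.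
by rewrite neq_ltn (leq_trans (ltn_ord i) Nj).
Qed.

Lemma schur_diagonal u :
  schur e (D1 \o adjoint D1) (D2 \o adjoint D2) u =
  \sum_(i < N) (`|a i * b i| ^+ 2 * ip (e (x i)) u) *: e (x i).
Proof.
have [bS hS] := schur_gramP hK he hf hD1 hD2; set S := schur _ _ _ in bS hS *.
have S1 i : I i -> S (e (x i)) = `|a i * b i| ^+ 2 *: e (x i).
  move=> Ii; apply: (coord_inj hK he) => x'; rewrite hS ipZr (basis_ip he).
  have [[j Ij <-]|nx] := pselect (exists2 j, I j & x j = x'); last first.
    rewrite (adjoint_diagonal_op0 hK he hf bnd1 aD1) => [|j Ij xj]; last first.
      by apply: nx; exists j.
    rewrite (ip0l hK) mul0r; case: eqP => [xi|_]; last by rewrite mulr0.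
    by case: nx; exists i.
  rewrite !(adjoint_diagonal_op hK he hf xI yI bnd1 aD1) //.
  rewrite !(adjoint_diagonal_op hK he hf xI yI bnd2 bD2) //.
  rewrite !(ipZl hK) !ipZr !(conj_invol hK) (basis_ip hf).
  have [<-|ij] := eqVneq j i.
    rewrite !eqxx !mulr1 !(mul_conj hK) normrM exprMn //.
  have -> : (y j == y i) = false by apply/eqP => /(yI Ij Ii)/eqP; rewrite (negbTE ij).
  have -> : (x j == x i) = false by apply/eqP => /(xI Ij Ii)/eqP; rewrite (negbTE ij).
  by rewrite !mulr0.
apply: (diagonal_expand hK he xI (l := fun i => `|a i * b i| ^+ 2)) => //.
- exact: (schur_gram_sym hK he hf hD1 hD2).
- by move=> i; rewrite (conj_real hK) // rpredX ?normr_real.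
- by move=> i iN; exact/S1/NI.
move=> x' nx; have [[j Ij xj]|nx'] := pselect (exists2 j, I j & x j = x').
  rewrite -xj S1 //; have [jN|Nj] := ltnP j N; first by case: (nx j jN xj).
  by rewrite abN // normr0 expr0n scale0r.
apply: (coord_inj hK he) => x''; rewrite hS.
rewrite [adjoint D1 (e x')](adjoint_diagonal_op0 hK he hf bnd1 aD1) => [|i Ii xi].
  by rewrite !ip0r mul0r.
by apply: nx'; exists i.
Qed.

Context {L : hilbertType conj} {Z : choiceType} {g : Z -> L}.
Hypothesis hg : orthonormal_basis g.
Variables (C3 : L -> H) (c : K) (v : L).
Hypothesis bC3 : bounded_op C3.
Hypothesis wN : forall i, (i < N)%N -> ip (e (x i)) (C3 v) != 0.
Hypothesis abE : forall i, (i < N)%N -> a i * b i = (conj (ip (e (x i)) (C3 v)))^-1.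

(** At [v] the difference of the two sides equals [N - c * N ^+ 2 = (1 - c * N) * N], which is
    negative. *)
Lemma not_schur_lower_bound : 1 < c * N%:R -> ~ schur_lower_bound e f D1 D2 C3 c.
Proof.
move=> cN [_ _ /(_ v)]; rewrite (lower_bound_form hK hg) //.
have -> : ip (C3 v) (diag_vec e (D1 \o transpose f e D2)) = N%:R.
  rewrite diag_vec_diagonal ip_sumr -[in RHS](card_ord N) -sumr_const.
  apply: eq_bigr => i _; rewrite ipZr abE // [ip (C3 v) _]ipC mulVf //.
  by rewrite (conj_eq0 hK) wN.
have -> : ip (C3 v) (schur e (D1 \o adjoint D1) (D2 \o adjoint D2) (C3 v)) = N%:R.
  rewrite schur_diagonal ip_sumr -[in RHS](card_ord N) -sumr_const.
  apply: eq_bigr => i _; rewrite ipZr [ip (C3 v) _]ipC -mulrA (mul_conj hK) abE //.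
  by rewrite normfV (norm_conj hK) -exprMn mulVf ?expr1n // normr_eq0 wN.
have N0 : (0 < N)%N by case: (N) cN => //; rewrite mulr0 ltr10.
rewrite ger0_norm ?ler0n // expr2 mulrA -[X in X - _]mul1r -mulrBl pmulr_lge0 ?ltr0n //.
by rewrite subr_ge0 => /(lt_le_trans cN); rewrite ltxx.
Qed.

End DiagonalForms.

(** [A] and [B] will be the supports of the two diagonals. They meet exactly in the first [N]
    indices, where the products [a_i b_i] live. The larger size [r] is one of the two ranks, hence
    bounded by the number of available basis vectors. *)
Lemma size_split (K : numFieldType) (arch : forall z : K, exists n : nat, `|z| < n%:R)
    (r1 r2 : option nat) (c : K) :
    r1 <> Some 0%N -> r2 <> Some 0%N -> inv_min_rank r1 r2 < c ->
  exists (N : nat) (A B : pred nat) (r : option nat), [/\ 1 < c * N%:R,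
    has_size A r1 /\ has_size B r2, forall i, A i && B i = (i < N)%N,
    r = r1 \/ r = r2 & forall i, A i || B i -> in_size r i].
Proof.
have inv (m : nat) : Some m <> Some 0%N -> m%:R^-1 < c -> 1 < c * m%:R.
  by case: m => // m _ mc; rewrite -ltr_pdivrMr ?ltr0n // div1r.
move=> r10 r20; case: r1 r10 => [m|] m0; case: r2 r20 => [n|] n0 /= cr.
- exists (minn m n), (fun i => i < m)%N, (fun i => i < n)%N, (Some (maxn m n)).
  split => //.
  + by apply: inv cr; rewrite /minn; case: ifP.
  + by move=> i; rewrite leq_min.
  + by rewrite /maxn; case: ifP; [right|left].
  + by move=> i /=; rewrite leq_max.
- exists m, (fun i => i < m)%N, predT, None; split => //.
  + exact: inv cr.
  + split=> //= k; exists val => //; exact: val_inj.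
  + by move=> i; rewrite andbT.
  + by right.
- exists n, predT, (fun i => i < n)%N, None; split => //.
  + exact: inv cr.
  + split=> //= k; exists val => //; exact: val_inj.
  + by left.
(* Here [c > 0] only, so [N] must exceed [1 / c]. Evens and odds keep both supports infinite with no
   common index beyond [N]. *)
- have [N cN] := arch c^-1.
  exists N, (fun i => (i < N)%N || ~~ odd i), (fun i => (i < N)%N || odd i), None.
  split => //.
  + by move: cN; rewrite ger0_norm ?invr_ge0 ?(ltW cr) // -div1r ltr_pdivrMr // mulrC.
  + split=> k /=.
      exists (fun i : 'I_k => i.*2) => [i j /double_inj/val_inj //|i].
      by rewrite odd_double orbT.
    exists (fun i : 'I_k => i.*2.+1) => [i j [] /double_inj/val_inj //|i].
    by rewrite /= odd_double orbT.
  + by move=> i; case: ltnP => //= _; case: odd.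
  + by left.
Qed.

Section Sharpness.
Context {K : numFieldType} {conj : K -> K} (hK : real_or_complex conj).
Context {H G : hilbertType conj} {X Y : choiceType} {e : X -> H} {f : Y -> G}.
Hypotheses (he : orthonormal_basis e) (hf : orthonormal_basis f).
Variable J : set X.

(** The compression factors through [P C], with [P] the coordinate projection, and the range of
    [P C] is spanned by the images of the finitely many [f y]. Hence [Y] is large enough to carry
    the diagonal operators. *)
Lemma rank_le_columns (C : G -> H) (F : {fset Y}) : bounded_op C ->
    setT = [set` F] ->
  exists2 m, rank (compress e J (C \o adjoint C)) = Some m & (m <= size F)%N.
Proof.
move=> bC YF; set A := compress _ _ _.
pose B := coord_proj e J \o C.
have lB : linear B by exact: bounded_linear (bounded_comp (bounded_coord_proj hK he J) bC).
have [|m mF rA] := rank_le (A := A) (v := fun i : 'I_(size F) => B (f (tnth (in_tuple F) i)))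
   (bounded_linear (bounded_compress_gram hK he hf J bC)); last by exists m.
move=> u; pose p := adjoint C (coord_proj e J u).
exists (fun i => ip (f (tnth (in_tuple F) i)) p).
rewrite -(big_tnth _ _ F xpredT (fun y => ip (f y) p *: B (f y))).
have pE : p = \sum_(y <- F) ip (f y) p *: f y.
  apply: (coord_inj hK hf) => y; rewrite (basis_ip_sum hf).
  have /= -> // : [set` F] y by rewrite -YF; exact: I.
rewrite -[A u]/(B p) {1}pE (linf_sum lB); apply: eq_bigr => y _.
by rewrite (linfZ lB).
Qed.

Lemma rank_neq0 (C : G -> H) : compress e J (C \o adjoint C) <> (fun=> 0) ->
  rank (compress e J (C \o adjoint C)) <> Some 0%N.
Proof.
move=> A0 /rank_SomeP[b [_ rA]]; apply: A0; apply/funext => u.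
have : range (compress e J (C \o adjoint C)) (compress e J (C \o adjoint C) u) by exists u.
by rewrite rA => -[c ->]; rewrite big_ord0.
Qed.

End Sharpness.

Theorem theorem2p4 (K : numFieldType) (conj : K -> K)
  (hK : real_or_complex conj)
  (H H1 H2 : hilbertType conj) (X Y Z : choiceType)
  (e : X -> H) (f : Y -> H1) (g : Z -> H2)
  (he : orthonormal_basis e) (hf : orthonormal_basis f)
  (hg : orthonormal_basis g)
  (C1 C2 : H1 -> H) (C3 : H2 -> H)
  (hC1 : hilbert_schmidt f C1) (hC2 : hilbert_schmidt f C2)
  (hC3 : hilbert_schmidt g C3) :
  let J := [set x | adjoint C3 (e x) <> 0] in
  compress e J (C1 \o adjoint C1) <> (fun=> 0) ->
  compress e J (C2 \o adjoint C2) <> (fun=> 0) ->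
  schur_lower_bound e f C1 C2 C3 (gamma e J C1 C2) /\
  (forall c : K, gamma e J C1 C2 < c ->
     exists C1' C2' : H1 -> H,
       [/\ hilbert_schmidt f C1', hilbert_schmidt f C2',
           rank (compress e J (C1' \o adjoint C1'))
             = rank (compress e J (C1 \o adjoint C1)),
           rank (compress e J (C2' \o adjoint C2'))
             = rank (compress e J (C2 \o adjoint C2))
         & ~ schur_lower_bound e f C1' C2' C3 c]).
Proof.
move=> J nz1 nz2; have [bC1 _] := hC1; have [bC2 _] := hC2; have [bC3 _] := hC3.
split; first exact: (schur_lower_bound_gamma hK he hf hg hC1 hC2 bC3).
move=> c gc.
have [N [A [B [r [cN [A1 B2] AB rr AI]]]]] :=
  size_split (archi hK) (rank_neq0 nz1) (rank_neq0 nz2) gc.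
have r0 : r <> Some 0%N by case: rr => ->; exact: rank_neq0.
have [x [xJ xI]] : exists x : nat -> X, (forall i, in_size r i -> J (x i)) /\
    (forall i j, in_size r i -> in_size r j -> x i = x j -> i = j).
  by apply: sequence_in => // F JF; case: rr => ->; exact: (rank_le_rows hK he hf).
have [y [_ yI]] : exists y : nat -> Y, (forall i, in_size r i -> [set: Y] (y i)) /\
    (forall i j, in_size r i -> in_size r j -> y i = y j -> i = j).
  by apply: sequence_in => // F YF; case: rr => ->; exact: (rank_le_columns hK he hf).
have NAB i : (i < N)%N -> A i /\ B i by rewrite -AB => /andP.
have NI i : (i < N)%N -> in_size r i by move=> /NAB[Ai _]; apply: AI; rewrite Ai.
have [v hv] : exists v, forall i, (i < N)%N -> ip (adjoint C3 (e (x i))) v != 0.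
  by apply: (nonvanishing hK) => i iN; exact/xJ/NI.
have wN i : (i < N)%N -> ip (e (x i)) (C3 v) != 0.
  by move=> iN; rewrite -(adjointP hK hg) // hv.
have t0 i : 2^-1 ^+ i != 0 :> K by rewrite expf_neq0 // invr_eq0 pnatr_eq0.
have tp i : 0 <= 2^-1 ^+ i :> K by rewrite exprn_ge0 // invr_ge0.
have t2 i : `|2^-1 ^+ i| ^+ 2 <= 2^-1 ^+ i :> K.
  rewrite ger0_norm // expr2 ler_piMl // exprn_ile1 ?invr_ge0 //.
  by rewrite invf_le1 // ler1n.
(* On the first [N] indices [b] is forced by [a_i b_i = 1 / conj w_i]; elsewhere both sequences
   decay geometrically on their supports. *)
pose a i : K := if A i then 2^-1 ^+ i else 0.
pose b i : K := if (i < N)%N then (a i * conj (ip (e (x i)) (C3 v)))^-1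
                else if B i then 2^-1 ^+ i else 0.
have a0 i : (a i == 0) = ~~ A i by rewrite /a; case: (A i); rewrite ?eqxx ?(negbTE (t0 i)).
have b0 i : (b i == 0) = ~~ B i.
  rewrite /b; case: ltnP => [iN|_].
    have [Ai ->] := NAB i iN; rewrite invr_eq0 mulf_eq0 a0 Ai (conj_eq0 hK).
    by rewrite (negbTE (wN i iN)).
  by case: (B i); rewrite ?eqxx ?(negbTE (t0 i)).
have [D1 hD1 aD1] : exists2 D1, hilbert_schmidt f D1 &
    diagonal_op (e := e) (f := f) (in_size r) x y a D1.
  apply: (diagonal_op_exists hK he hf x yI (M := 1)) => i; rewrite mul1r /a.
  by case: (A i) => //; rewrite normr0 expr0n.
have [D2 hD2 bD2] : exists2 D2, hilbert_schmidt f D2 &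
    diagonal_op (e := e) (f := f) (in_size r) x y b D2.
  (* For [i < N] the [i]-th summand alone gives the required [M * 2^-1 ^+ i]; the added 1 handles
     [i >= N]. *)
  pose M : K := \sum_(j < N) `|b j| ^+ 2 * 2 ^+ j + 1.
  have s0 : 0 <= \sum_(j < N) `|b j| ^+ 2 * 2 ^+ j.
    by apply: sumr_ge0 => j _; rewrite mulr_ge0 ?exprn_ge0.
  apply: (diagonal_op_exists hK he hf x yI (M := M)) => i.
  have [iN|Ni] := ltnP i N; last first.
    have bi : `|b i| ^+ 2 <= 2^-1 ^+ i.
      rewrite /b ltnNge Ni /=; case: (B i) => //; by rewrite normr0 expr0n.
    by rewrite (le_trans bi) // ler_peMl // lerDr.
  rewrite exprVn ler_pdivlMr ?exprn_gt0 // /M (bigD1 (Ordinal iN)) //= -addrA lerDl.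
  by rewrite addr_ge0 // sumr_ge0 // => j _; rewrite mulr_ge0 ?exprn_ge0.
have bd1 : bounded_op D1 by case: hD1.
have bd2 : bounded_op D2 by case: hD2.
exists D1, D2; split => //.
- apply: (rank_diagonal_op hK he hf xI yI xJ bd1 aD1 A1) => // i Ai.
  by apply: AI; rewrite Ai.
- apply: (rank_diagonal_op hK he hf xI yI xJ bd2 bD2 B2) => // i Bi.
  by apply: AI; rewrite Bi orbT.
apply: (not_schur_lower_bound hK he hf xI yI hD1 hD2 aD1 bD2 NI _ hg bC3 wN _ cN).
  move=> i Ni; rewrite /b /a ltnNge Ni /=; have := AB i; rewrite ltnNge Ni /=.
  by case: (A i); case: (B i) => //; rewrite ?mul0r ?mulr0.
move=> i iN; rewrite /b iN invfM mulrA mulfV ?mul1r //.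
by rewrite a0; have [-> _] := NAB i iN.
Qed.
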